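(* Let $V$ be a grading-restricted vertex superalgebra, $g$ an automorphism of $V$, and $\mathcal{S}_g$, $\mathcal{N}_g$ the semisimple and nilpotent parts of the logarithm of $g$, so that $g=e^{2\pi i(\mathcal{S}_g+\mathcal{N}_g)}$ on $V$. Then: 1. The operators $e^{2\pi i\mathcal{S}_{g}}$ and $e^{2\pi i\mathcal{N}_{g}}$ are also automorphisms of $V$. 2. The operator $\mathcal{N}_{g}$ is a derivation of $V$, that is, for every $u\in V$, $[\mathcal{N}_{g}, Y_{V}(u, x)]=Y_{V}(\mathcal{N}_{g}u, x)$. 3. For any $t\in \mathbb{C}$, $e^{t\mathcal{N}_{g}}$ is an automorphism of $V$. For any formal variable $y$ and $u, v\in V$, $$e^{y\mathcal{N}_{g}}Y_{V}(u, x)v=Y_{V}(e^{y\mathcal{N}_{g}}u, x)e^{y\mathcal{N}_{g}}v.$$ In particular, when $y=\log x_{0}$, $$x_{0}^{\mathcal{N}_{g}}Y_{V}(u, x)v=Y_{V}(x_{0}^{\mathcal{N}_{g}}u, x)x_{0}^{\mathcal{N}_{g}}v.$$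
   Context: Here $x,y,x_0$ are formal variables, $\log x_0$ is also a formal variable, and $x_0^{\mathcal N_g}:=e^{(\log x_0)\mathcal N_g}$. A grading-restricted vertex superalgebra is a $\frac{\mathbb Z}{2}$-graded complex vector space $V=\coprod_{n\in\frac{\mathbb Z}{2}}V_{(n)}$ with a linear map $Y_V:V\otimes V\to V[[x,x^{-1}]]$, $u\otimes v\mapsto Y_V(u,x)v$, and a vacuum $\mathbf 1\in V_{(0)}$ such that: (i) $\dim V_{(n)}<\infty$ and $V_{(n)}=0$ for $n$ sufficiently negative; with $L_V(0)v=nv$ for $v\in V_{(n)}$, $[L_V(0),Y_V(v,x)]=x\frac{d}{dx}Y_V(v,x)+Y_V(L_V(0)v,x)$; (ii) $Y_V(\mathbf 1,x)=1_V$ and $\lim_{x\to0}Y_V(u,x)\mathbf 1$ exists and equals $u$; (iii) with $L_V(-1)v=\lim_{x\to0}\frac{d}{dx}Y_V(v,x)\mathbf 1$, $\frac{d}{dx}Y_V(v,x)=Y_V(L_V(-1)v,x)=[L_V(-1),Y_V(v,x)]$; (iv) duality: for $u_1,u_2$ each in $\coprod_{n\in\mathbb Z}V_{(n)}$ (put $|u_i|=0$) or in $\coprod_{n\in\mathbb Z+\frac12}V_{(n)}$ (put $|u_i|=1$), $v\in V$, $v'\in V'=\coprod_n V_{(n)}^*$, the series $\langle v',Y_V(u_1,z_1)Y_V(u_2,z_2)v\rangle$, $(-1)^{|u_1||u_2|}\langle v',Y_V(u_2,z_2)Y_V(u_1,z_1)v\rangle$, $\langle v',Y_V(Y_V(u_1,z_1-z_2)u_2,z_2)v\rangle$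 converge absolutely in the regions $|z_1|>|z_2|>0$, $|z_2|>|z_1|>0$, $|z_2|>|z_1-z_2|>0$, respectively, to a common rational function of $z_1,z_2$ whose only possible poles are at $z_1=0$, $z_2=0$, $z_1=z_2$. An automorphism of $V$ is a weight-preserving invertible linear map $g:V\to V$ with $gY_V(u,x)v=Y_V(gu,x)gv$ for $u,v\in V$. Let $P_V$ be the set of $\alpha\in\mathbb C$ with $0\le\Re(\alpha)<1$ such that $e^{2\pi i\alpha}$ is an eigenvalue of $g$, and $V^{[\alpha]}$ the generalized eigenspace of $g$ on $V$ with eigenvalue $e^{2\pi i\alpha}$, so $V=\coprod_{\alpha\in P_V}V^{[\alpha]}$. The semisimple operator $\mathcal S_g$ acts on $V^{[\alpha]}$ as multiplication by $\alpha$. The operator $\mathcal N_g=\frac1{2\pi i}\log\bigl(1_V+(e^{-2\pi i\mathcal S_g}g-1_V)\bigr)=\frac{1}{2\pi i}\sum_{j\ge1}\frac{(-1)^{j+1}}{j}(e^{-2\pi i\mathcal S_g}g-1_V)^j$ is nilpotent on each $V_{(n)}$; $\mathcal S_g$ and $\mathcal N_g$ commute and $g=e^{2\pi i(\mathcal S_g+\mathcal N_g)}$. *)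

(* Defs.v *)
From HB Require Import structures.
From mathcomp Require Import all_boot all_order all_algebra.
From mathcomp Require Import complex.
From mathcomp Require Import all_classical all_reals all_analysis.
From mathcomp.analysis.showcase Require summability.

Set Implicit Arguments.
Unset Strict Implicit.
Unset Printing Implicit Defensive.

Import Order.TTheory GRing.Theory Num.Theory.
Import numFieldNormedType.Exports.

Local Open Scope classical_set_scope.
Local Open Scope ring_scope.
Local Open Scope complex_scope.

Definition expC (R : realType) (z : R[i]) : R[i] :=
  (expR (complex.Re z))%:C * (cos (complex.Im z) +i* sin (complex.Im z)).

Definition twopii (R : realType) : R[i] := 0 +i* (2 * pi).

Section FormalSeries.
Variables (R : realType) (V : lmodType R[i]).

(* V[[x, x^-1]]; [f n] is the coefficient of x^n (not of x^(-n-1)). *)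
Definition dseries : Type := int -> V.

Definition ddx (f : dseries) : dseries := fun n => (n + 1)%:~R *: f (n + 1).

Definition mulx (f : dseries) : dseries := fun n => f (n - 1).

(* lim_{x -> 0} f(x) exists: f has no negative powers of x; the limit is then
   the constant term. *)
Definition lim_x0 (f : dseries) (w : V) : Prop :=
  (forall n : int, n < 0 -> f n = 0) /\ f 0 = w.

(* V[[y]]; [f k] is the coefficient of y^k. *)
Definition pseries : Type := nat -> V.

End FormalSeries.

Section Analytic.
Variable R : realType.

Definition abs_converges_to (a : int * int -> R[i]) (s : R[i]) : Prop :=
  summable [set: int * int] (fun p => (ComplexField.Normc.normc (a p))%:E) /\
  summability.partial_sum (a : int * int -> R[i]^o) @ summability.totally
    --> (s : R[i]^o).

(* Value at (z1, z2) of p(z1, z2) / (z1^a z2^b (z1 - z2)^c), where the outer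
   indeterminate of p is z1 and the inner one is z2. *)
Definition ratfun (p : {poly {poly R[i]}}) (a b c : nat) (z1 z2 : R[i]) :
  R[i] := p.[z1%:P].[z2] / (z1 ^+ a * z2 ^+ b * (z1 - z2) ^+ c).

End Analytic.

Section Grading.
Variables (R : realType) (V : lmodType R[i]).

(* A (Z/2)-grading is given by the projections pr k : V -> V_(k/2); the index
   k : int is twice the weight. *)
Variable pr : int -> {linear V -> V}.

Definition wtspace (k : int) : set V := [set v | pr k v = v].

Definition is_grading : Prop :=
  [/\ forall k l v, pr k (pr l v) = if k == l then pr l v else 0,
      forall v, finite_set [set k | pr k v != 0] &
      forall v, v = \sum_(k \in [set: int]) pr k v].

Definition wt_op (v : V) : V :=
  \sum_(k \in [set: int]) (k%:~R / 2) *: pr k v.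

(* [has_parity false]: the sum of the V_(n), n in Z;
   [has_parity true]: the sum of the V_(n), n in Z + 1/2. *)
Definition has_parity (b : bool) (v : V) : Prop :=
  forall k : int, pr k v != 0 -> odd `|k|%N = b.

(* V', the direct sum of the V_(n)^*, as linear forms on V. *)
Definition graded_dual : set {scalar V} :=
  [set v' | finite_set [set k | exists v, v' (pr k v) != 0]].

End Grading.

Section Duality.
Variables (R : realType) (V : lmodType R[i]).
Variables (pr : int -> {linear V -> V}) (Y : V -> V -> dseries V) (vac : V).

(* L(-1) v is the constant term of d/dx Y(v, x) 1. *)
Definition transl_op (v : V) : V := ddx (Y v vac) 0.

Definition duality : Prop :=
  forall (b1 b2 : bool) (u1 u2 v : V) (v' : {scalar V}),
    has_parity pr b1 u1 -> has_parity pr b2 u2 -> graded_dual pr v' ->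
  exists (p : {poly {poly R[i]}}) (a b c : nat), forall z1 z2 : R[i],
  [/\ 0 < `|z2| < `|z1| ->
        abs_converges_to
          (fun mn => v' (Y u1 (Y u2 v mn.2) mn.1) * z1 ^ mn.1 * z2 ^ mn.2)
          (ratfun p a b c z1 z2),
      0 < `|z1| < `|z2| ->
        abs_converges_to
          (fun mn => (-1) ^+ (b1 && b2) *
            (v' (Y u2 (Y u1 v mn.1) mn.2) * z1 ^ mn.1 * z2 ^ mn.2))
          (ratfun p a b c z1 z2) &
      0 < `|z1 - z2| < `|z2| ->
        abs_converges_to
          (fun mn =>
            v' (Y (Y u1 u2 mn.1) v mn.2) * (z1 - z2) ^ mn.1 * z2 ^ mn.2)
          (ratfun p a b c z1 z2)].

End Duality.

(* [gv_Y A u v n] is the coefficient of x^n in Y_V(u, x) v. *)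
Record gr_vertex_superalgebra (R : realType) (V : lmodType R[i]) := {
  gv_pr : int -> {linear V -> V};
  gv_Y : V -> V -> dseries V;
  gv_vac : V;
  gv_grading : is_grading gv_pr;
  gv_linear_l : forall v n, linear (fun u => gv_Y u v n);
  gv_linear_r : forall u n, linear (fun v => gv_Y u v n);
  gv_vac_wt : wtspace gv_pr 0 gv_vac;
  gv_findim : forall k, exists s : seq V, forall v, wtspace gv_pr k v ->
    exists c : nat -> R[i], v = \sum_(i < size s) c i *: s`_i;
  gv_lower : exists k0 : int, forall k, k < k0 ->
    forall v, wtspace gv_pr k v -> v = 0;
  gv_L0_bracket : forall (v w : V) (n : int),
    wt_op gv_pr (gv_Y v w n) - gv_Y v (wt_op gv_pr w) n =
    mulx (ddx (gv_Y v w)) n + gv_Y (wt_op gv_pr v) w n;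
  gv_vacuum : forall (v : V) (n : int),
    gv_Y gv_vac v n = if n == 0 then v else 0;
  gv_creation : forall u, lim_x0 (gv_Y u gv_vac) u;
  gv_transl_deriv : forall (v w : V) (n : int),
    ddx (gv_Y v w) n = gv_Y (transl_op gv_Y gv_vac v) w n;
  gv_transl_bracket : forall (v w : V) (n : int),
    ddx (gv_Y v w) n =
    transl_op gv_Y gv_vac (gv_Y v w n) - gv_Y v (transl_op gv_Y gv_vac w) n;
  gv_duality : duality gv_pr gv_Y
}.

Section Operators.
Variables (R : realType) (V : lmodType R[i]) (A : gr_vertex_superalgebra V).

Definition is_automorphism (g : V -> V) : Prop :=
  [/\ linear g, bijective g,
      forall (k : int) (v : V),
        wtspace (gv_pr A) k v -> wtspace (gv_pr A) k (g v) &
      forall (u v : V) (n : int), g (gv_Y A u v n) = gv_Y A (g u) (g v) n].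

Definition is_derivation (D : V -> V) : Prop :=
  linear D /\
  forall (u v : V) (n : int),
    D (gv_Y A u v n) - gv_Y A u (D v) n = gv_Y A (D u) v n.

(* The sum of the series of the a k, in the topology of coefficientwise
   convergence against V'. On terms staying in finitely many V_(n) this is the
   usual finite-dimensional convergence. *)
Definition vsum (a : nat -> V) : V :=
  xget 0 [set w : V | forall v' : {scalar V}, graded_dual (gv_pr A) v' ->
    (fun n : nat => \sum_(k < n) v' (a k) : R[i]^o) @ \oo
      --> (v' w : R[i]^o)].

(* e^(z T) for a scalar z *)
Definition expop (z : R[i]) (T : V -> V) (v : V) : V :=
  vsum (fun k => (z ^+ k / k`!%:R) *: iter k T v).

Variable g : V -> V.

Definition P_V : set R[i] :=
  [set alpha | 0 <= complex.Re alpha < 1 /\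
    exists2 v : V, v != 0 & g v = expC (twopii R * alpha) *: v].

Definition gen_eigenspace (alpha : R[i]) : set V :=
  [set v | exists k : nat,
    iter k (fun w => g w - expC (twopii R * alpha) *: w) v = 0].

(* S_g: acts on v = \sum_alpha v_alpha, with v_alpha in V^[alpha] for alpha in P_V,
   as \sum_alpha alpha v_alpha. *)
Definition log_ss (v : V) : V :=
  xget 0 [set w : V | exists (s : seq R[i]) (c : R[i] -> V),
    [/\ uniq s,
        forall alpha, alpha \in s ->
          P_V alpha /\ gen_eigenspace alpha (c alpha),
        v = \sum_(alpha <- s) c alpha &
        w = \sum_(alpha <- s) alpha *: c alpha]].

(* e^(-2 pi i S_g) g - 1_V *)
Definition unip_minus_id (v : V) : V := expop (- twopii R) log_ss (g v) - v.

(* N_g; the summation index is shifted by one, starting at 0. *)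
Definition log_nil (v : V) : V :=
  (twopii R)^-1 *:
  vsum (fun j => ((-1) ^+ j / j.+1%:R) *: iter j.+1 unip_minus_id v).

End Operators.

Section FormalExp.
Variables (R : realType) (V : lmodType R[i]) (A : gr_vertex_superalgebra V).

(* e^(y T) v in V[[y]], for a formal variable y *)
Definition fexp (T : V -> V) (v : V) : pseries V :=
  fun k => (k`!%:R)^-1 *: iter k T v.

(* x0^T v := e^((log x0) T) v; the coefficients are those of the powers of the
   formal variable log x0. *)
Definition fpow (T : V -> V) (v : V) : pseries V := fexp T v.

(* Y_V(a(y), x) b(y) for a(y), b(y) in V[[y]]: the coefficient of x^n y^k *)
Definition Yseries (a b : pseries V) (n : int) : pseries V :=
  fun k => \sum_(i < k.+1) gv_Y A (a i) (b (k - i)%N) n.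

End FormalExp.

(* Main.v *)
Require Import Defs.
From HB Require Import structures.
From mathcomp Require Import all_boot all_order all_algebra.
From mathcomp Require Import complex.
From mathcomp Require Import all_classical all_reals all_analysis.
From mathcomp Require Import ring lra.

Set Implicit Arguments.
Unset Strict Implicit.
Unset Printing Implicit Defensive.

Import Order.TTheory GRing.Theory Num.Theory.
Import numFieldNormedType.Exports.

Local Open Scope classical_set_scope.
Local Open Scope ring_scope.
Local Open Scope complex_scope.

(** The logarithm of [g] is split over generalized eigenspaces. Each weight
space is finite-dimensional and stable under [g], so every vector is killed by
a nonzero polynomial in [g] and, the field being algebraically closed, is a
finite sum of generalized eigenvectors ([gen_eigen_decomp]). For a function [f]
on eigenvalues, the operator [spectral_op g f] multiplies the generalized
eigenspace of [l] by [f l]. Hermite interpolation shows that on any given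
vector it agrees with a polynomial in [g] ([spectral_rel_polyop]); hence it is
well defined, and it preserves the weight spaces. The modes of [Y] send
generalized eigenvectors for [l] and [m] to one for [l * m]
([gen_eigen_mult]), so [spectral_op g f] respects [Y] whenever [f] is
multiplicative. Now [log_ss] is [spectral_op] of the branch of
[log / 2 pi i] with real part at least [0] and less than [1], and summing the
exponential series turns [e^(2 pi i S)] into [spectral_op] of the identity, and
[e^(-2 pi i S)] into [spectral_op] of the inverse; the first is therefore an
automorphism and the unipotent part [h = e^(-2 pi i S) g] respects [Y] as well.

Write [h = 1 + U] with [U] locally nilpotent. The vector
[h^n v = \sum_j 'C(n, j) U^j v] is polynomial in [n], with linear coefficient
[\sum_j (-1)^(j-1) / j U^j v], that is, [log h] at [v]. Both sides of
[h^n Y(u, x) v = Y(h^n u, x) h^n v] are polynomial in [n], so their linear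
coefficients agree, which says that [log h], hence [N], is a derivation
([log_trunc_derivation]). Exponentiating a locally nilpotent derivation gives
automorphisms by the Leibniz rule ([divided_leibniz], [exp_trunc_mult]), and
the Leibniz rule with divided powers is also the statement for a formal
variable.

The infinite sums are limits tested against the graded dual. That dual
separates points because the weight spaces are finite-dimensional
([separating_form]), so such sums are unique; those for [N] and [e^(t N)] have
finitely many nonzero terms on each vector, and those for [e^(z S)] reduce to
the scalar exponential series ([cvg_exp_psum]). *)

(** * The complex exponential and its logarithm *)

Definition exp_psum (F : fieldType) (z : F) (n : nat) : F :=
  \sum_(k < n) z ^+ k / k`!%:R.

Lemma fact_neq0 (F : numDomainType) (n : nat) : (n`!)%:R != 0 :> F.
Proof. by rewrite pnatr_eq0 -lt0n fact_gt0. Qed.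

Lemma bin_divfact (F : numFieldType) (n i : nat) : (i <= n)%N ->
  'C(n, i)%:R / n`!%:R = (i`!%:R)^-1 * ((n - i)`!%:R)^-1 :> F.
Proof.
move=> le_in; rewrite -(bin_fact le_in) natrM natrM.
have := fact_neq0 F i; have := fact_neq0 F (n - i).
have : 'C(n, i)%:R != 0 :> F by rewrite pnatr_eq0 -lt0n bin_gt0.
by move=> *; field; apply/and3P.
Qed.

(** Both sides run over the pairs of indices whose sum is below [n]; this is how
the coefficients of a product of two power series are regrouped. *)
Lemma triangle_sum (V : nmodType) (n : nat) (G : nat -> nat -> V) :
  \sum_(k < n) \sum_(i < k.+1) G i (k - i)%N =
  \sum_(i < n) \sum_(j < n | ~~ (n <= i + j)%N) G i j.
Proof.
transitivity (\sum_(k < n) \sum_(i < n | (i <= k)%N) G i (k - i)%N).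
  apply: eq_bigr => k _.
  by rewrite (big_ord_widen_cond _ xpredT (fun i => G i (k - i)%N) (ltn_ord k)).
rewrite (exchange_big_dep xpredT) //=; apply: eq_bigr => i _.
rewrite -(big_mkord (fun k => i <= k)%N (fun k => G i (k - i)%N)).
rewrite -(big_mkord (fun j => ~~ (n <= i + j))%N (fun j => G i j)).
rewrite [LHS](big_cat_nat _ (n := i)) //=; last exact: ltnW.
rewrite big_nat_cond big_pred0 ?add0r; last first.
  by move=> k; rewrite leq0n /=; case: ltnP.
rewrite [RHS](big_cat_nat _ (n := n - i)) ?leq_subr //=.
rewrite [X in _ + X]big_nat_cond.
rewrite [X in _ + X]big_pred0 ?addr0; last first.
  by move=> k; rewrite leq_subLR andbAC andbN.
rewrite -{1}[nat_of_ord i]add0n big_addn [LHS]big_nat_cond [RHS]big_nat_cond.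
apply: eq_big => k; rewrite ?addnK //.
by rewrite leq_addl andbT -ltnNge -ltn_subRL leq0n /= andbb.
Qed.

Lemma exp_psum_prodB (F : numFieldType) (x y : F) (n : nat) :
  exp_psum x n * exp_psum y n - exp_psum (x + y) n =
  \sum_(i < n) \sum_(j < n | (n <= i + j)%N)
    (x ^+ i / i`!%:R) * (y ^+ j / j`!%:R).
Proof.
have -> : exp_psum (x + y) n = \sum_(i < n) \sum_(j < n | ~~ (n <= i + j)%N)
    (x ^+ i / i`!%:R) * (y ^+ j / j`!%:R).
  rewrite -(triangle_sum _ (fun i j => (x ^+ i / i`!%:R) * (y ^+ j / j`!%:R))).
  apply: eq_bigr => k _; rewrite addrC exprDn mulr_suml; apply: eq_bigr => i _.
  rewrite -mulr_natr -!mulrA bin_divfact -1?ltnS //.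
  by field; rewrite !fact_neq0.
rewrite big_distrlr /= -sumrB; apply: eq_bigr => i _.
by rewrite [X in X - _](bigID (fun j : 'I_n => n <= i + j)%N) /= addrK.
Qed.

(** The partial sums of [e^x e^y] and [e^(x + y)] differ by the terms above the
diagonal, which are dominated by those for the absolute values; the complex
case thus reduces to the real one. *)
Lemma exp_psum_prodB_le (F : numFieldType) (x y : F) (n : nat) :
  `|exp_psum x n * exp_psum y n - exp_psum (x + y) n| <=
  exp_psum `|x| n * exp_psum `|y| n - exp_psum (`|x| + `|y|) n.
Proof.
rewrite !exp_psum_prodB; apply: le_trans (ler_norm_sum _ _ _) _.
apply: ler_sum => i _; apply: le_trans (ler_norm_sum _ _ _) _.
by apply: ler_sum => j _; rewrite !normrM !normfV !normr_nat !normrX.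
Qed.

Section ComplexExp.
Variable R : realType.
Local Notation C := R[i].

Lemma cvg_complex (u : nat -> C) (a b : R) :
  (fun n => complex.Re (u n)) @ \oo --> a ->
  (fun n => complex.Im (u n)) @ \oo --> b ->
  (u : nat -> C^o) @ \oo --> (a +i* b : C^o).
Proof.
move=> /cvgrPdist_lt cva /cvgrPdist_lt cvb; apply/cvgrPdist_lt => -[e e'].
rewrite ltcE /= => /andP[/eqP -> e0].
have e20 : 0 < e / 2 by rewrite divr_gt0.
near=> n.
have uE : a +i* b - u n =
    (a - complex.Re (u n))%:C + 'i%C * (b - complex.Im (u n))%:C.
  case: (u n) => c d /=; apply/eqP.
  by rewrite eq_complex /=; apply/andP; split; apply/eqP; ring.
rewrite [X in `|X|]uE.
apply: le_lt_trans (ler_normD _ _) _.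
rewrite normrM.
have -> : `|'i%C| = 1 :> C by rewrite normc_def /= expr0n expr1n add0r sqrtr1.
have nR (x : R) : `|x%:C| = `|x|%:C :> C.
  by rewrite normc_def /= expr0n addr0 sqrtr_sqr.
rewrite mul1r !nR -rmorphD /= ltcR [e]splitr; apply: ltrD; near: n.
- exact: cva.
- exact: cvb.
Unshelve. all: by end_near. Qed.

Lemma exp_psum_realC (x : R) n : exp_psum x%:C n = (exp_psum x n)%:C.
Proof.
rewrite /exp_psum [RHS](rmorph_sum (real_complex R)); apply: eq_bigr => k _ /=.
rewrite [RHS](rmorphM (real_complex R)) /= rmorphXn /= fmorphV.
by rewrite [in RHS]rmorph_nat.
Qed.

Lemma cvg_exp_psum_real (x : R) : exp_psum x n @[n --> \oo] --> expR x.
Proof.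
have -> : exp_psum x = series (exp_coeff x).
  by apply/funext => n; rewrite /series /= big_mkord.
exact: is_cvg_series_exp_coeff.
Qed.

Lemma exp_term_imag (y : R) (k : nat) :
  ('i%C * y%:C) ^+ k / k`!%:R = cos_coeff y k +i* sin_coeff y k.
Proof.
have -> : ('i%C * y%:C) ^+ k / k`!%:R = 'i%C ^+ k * (y ^+ k / k`!%:R)%:C :> C.
  rewrite exprMn [in RHS](rmorphM (real_complex R)) /=.
  rewrite [(y ^+ k)%:C](rmorphXn (real_complex R)) /=.
  by rewrite [in RHS](fmorphV (real_complex R)) /= [in RHS]rmorph_nat mulrA.
rewrite /cos_coeff /sin_coeff /=.
have -> : 'i%C ^+ k =
    ((~~ odd k)%:R * (-1) ^+ k./2) +i* ((odd k)%:R * (-1) ^+ k.-1./2) :> C.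
  rewrite -{1}(odd_double_half k) exprD -mul2n exprM sqr_i.
  have -> : (-1 : C) ^+ k./2 = ((-1) ^+ k./2)%:C by rewrite rmorphXn rmorphN1.
  case: (boolP (odd k)) => ok /=.
    have -> : k.-1./2 = k./2.
      by case: k ok => //= k; rewrite uphalf_half => /negPf->.
    rewrite expr1; apply/eqP; rewrite eq_complex /= !(mul0r, mulr0, mul1r).
    by rewrite subr0 add0r !eqxx.
  rewrite expr0 !mul1r; apply/eqP.
  by rewrite eq_complex /= !(mul0r, mulr0, mul1r) !eqxx.
by apply/eqP; rewrite eq_complex /= !mulr0 subr0 add0r !mulrA !eqxx.
Qed.

Lemma cvg_exp_psum_imag (y : R) :
  (exp_psum ('i%C * y%:C) : nat -> C^o) @ \oo --> (cos y +i* sin y : C^o).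
Proof.
have E n : exp_psum ('i%C * y%:C) n =
    series (cos_coeff y) n +i* series (sin_coeff y) n.
  rewrite /exp_psum /series /= !big_mkord.
  elim: n => [|n IH]; first by rewrite !big_ord0.
  by rewrite !big_ord_recr /= IH exp_term_imag.
apply: cvg_complex.
- have -> : (fun n => complex.Re (exp_psum ('i%C * y%:C) n)) =
    series (cos_coeff y).
    by apply/funext => n; rewrite E.
  rewrite unlock; exact: is_cvg_series_cos_coeff.
- have -> : (fun n => complex.Im (exp_psum ('i%C * y%:C) n)) =
    series (sin_coeff y).
    by apply/funext => n; rewrite E.
  rewrite unlock; exact: is_cvg_series_sin_coeff.
Qed.

(** The series at [x + i y] has the same limit as the product of the series at
[x] and at [i y]: by [exp_psum_prodB_le] the difference is dominated by a real
sequence tending to [e^|x| e^|y| - e^(|x| + |y|) = 0]. *)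
Lemma cvg_exp_psum (z : C) :
  (exp_psum z : nat -> C^o) @ \oo --> (expC z : C^o).
Proof.
case: z => x y.
have zE : x +i* y = x%:C + 'i%C * y%:C :> C by rewrite [LHS]complexE.
have cprod : (fun n => exp_psum x%:C n * exp_psum ('i%C * y%:C) n : C^o) @ \oo
    --> (expC (x +i* y) : C^o).
  apply: cvgM; last exact: cvg_exp_psum_imag.
  apply: cvg_complex => /=.
  - under eq_fun do rewrite exp_psum_realC /=; exact: cvg_exp_psum_real.
  - under eq_fun do rewrite exp_psum_realC /=; exact: cvg_cst.
have cdiff : (fun n => exp_psum x%:C n * exp_psum ('i%C * y%:C) n -
    exp_psum (x +i* y) n : C^o) @ \oo --> (0 : C^o).
  have cr : (fun n => exp_psum `|x| n * exp_psum `|y| n -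
      exp_psum (`|x| + `|y|) n) @ \oo --> (0 : R).
    have := cvgB (cvgM (@cvg_exp_psum_real `|x|) (@cvg_exp_psum_real `|y|))
      (@cvg_exp_psum_real (`|x| + `|y|)).
    by rewrite expRD subrr; exact.
  apply/cvgrPdist_lt => -[e e']; rewrite ltcE /= => /andP[/eqP -> e0].
  move/cvgrPdist_lt: cr => /(_ e e0) cr; near=> n.
  rewrite sub0r normrN zE.
  apply: le_lt_trans (exp_psum_prodB_le _ _ _) _.
  have -> : `|'i%C * y%:C| = `|y|%:C :> C.
    rewrite normrM !normc_def /= !expr0n expr1n add0r addr0.
    by rewrite sqrtr1 mul1r sqrtr_sqr.
  have -> : `|x%:C| = `|x|%:C :> C.
    by rewrite normc_def /= expr0n addr0 sqrtr_sqr.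
  rewrite -rmorphD !exp_psum_realC -rmorphM -rmorphB ltcR.
  near: n; apply: filterS cr => n; rewrite sub0r normrN.
  exact/le_lt_trans/ler_norm.
have -> : exp_psum (x +i* y) = (fun n =>
    exp_psum x%:C n * exp_psum ('i%C * y%:C) n -
    (exp_psum x%:C n * exp_psum ('i%C * y%:C) n - exp_psum (x +i* y) n)).
  by apply/funext => n; rewrite opprB addrC subrK.
have cv := cvgB cprod cdiff; rewrite subr0 in cv; exact: cv.
Unshelve. all: by end_near. Qed.

Lemma expCD (z w : C) : expC (z + w) = expC z * expC w.
Proof.
case: z w => [a b] [c d]; apply/eqP; rewrite eq_complex /= expRD cosD sinD.
by apply/andP; split; apply/eqP; ring.
Qed.

Lemma expC0 : expC 0 = 1 :> C.
Proof.
apply/eqP; rewrite eq_complex /= expR0 cos0 sin0.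
by rewrite !mul0r !mulr0 mulr1 subr0 addr0 !eqxx.
Qed.

Lemma expC_neq0 (z : C) : expC z != 0.
Proof.
apply/eqP => z0; have := expCD z (- z).
by rewrite subrr expC0 z0 mul0r => /eqP; rewrite oner_eq0.
Qed.

Lemma expCN (z : C) : expC (- z) = (expC z)^-1.
Proof.
by apply: (mulfI (expC_neq0 z)); rewrite -expCD subrr expC0 divff ?expC_neq0.
Qed.

Lemma expC_twopii (a b : R) :
  expC (twopii R * (a +i* b)) =
  (expR (- (2 * pi * b)))%:C * (cos (2 * pi * a) +i* sin (2 * pi * a)).
Proof.
rewrite /twopii /expC /=; congr ((expR _)%:C * (cos _ +i* sin _)); ring.
Qed.

Lemma normc_polar (r t : R) : 0 <= r ->
  ComplexField.Normc.normc (r%:C * (cos t +i* sin t)) = r.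
Proof.
move=> r0; rewrite ComplexField.Normc.normcM /= cos2Dsin2 sqrtr1 mulr1.
by rewrite expr0n addr0 sqrtr_sqr ger0_norm.
Qed.

(** The modulus determines the imaginary part of [x], and the argument its real
part up to an integer, which the half-open strip makes zero. *)
Lemma expC_twopii_inj (x y : C) :
  0 <= complex.Re x < 1 -> 0 <= complex.Re y < 1 ->
  expC (twopii R * x) = expC (twopii R * y) -> x = y.
Proof.
case: x y => [a b] [c d] /= /andP[a0 a1] /andP[c0 c1].
rewrite !expC_twopii => E.
have pi0 := pi_gt0 R.
have Er : expR (- (2 * pi * b)) = expR (- (2 * pi * d)).
  have := congr1 (@ComplexField.Normc.normc R) E.
  by rewrite !normc_polar ?expR_ge0.
have bd : b = d.
  move/expR_inj: Er => /oppr_inj; apply: mulfI.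
  by rewrite mulf_neq0 ?gt_eqF.
move: E; rewrite Er => /mulfI E; have {}E := E _.
have /E[cE sE] : (expR (- (2 * pi * d)))%:C != 0 :> C.
  by rewrite fmorph_eq0 gt_eqF ?expR_gt0.
have c1' : cos (2 * (pi * (a - c))) = 1.
  have -> : 2 * (pi * (a - c)) = 2 * pi * a - 2 * pi * c by ring.
  by rewrite cosB cE sE -!expr2 cos2Dsin2.
have s0 : sin (pi * (a - c)) = 0.
  apply/eqP; rewrite -sqrf_eq0 sin2cos2; apply/eqP.
  by move: c1'; rewrite mulr_natl cos_mulr2n; lra.
rewrite bd; congr (_ +i* _).
have [ac|ca|//] := ltgtP a c.
- have : 0 < sin (pi * (c - a)).
    by apply: sin_gt0_pi; rewrite mulr_gt0 ?subr_gt0 //= gtr_pMr //; lra.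
  by rewrite -(opprB a c) mulrN sinN s0 oppr0 ltxx.
- have : 0 < sin (pi * (a - c)).
    by apply: sin_gt0_pi; rewrite mulr_gt0 ?subr_gt0 //= gtr_pMr //; lra.
  by rewrite s0 ltxx.
Qed.

(** [acos] reaches the upper half circle; the lower one is its reflection. *)
Lemma cos_sin_surj (a b : R) : a ^+ 2 + b ^+ 2 = 1 ->
  exists2 t, 0 <= t < 2 * pi & cos t = a /\ sin t = b.
Proof.
move=> ab; have pi0 := pi_gt0 R.
have a1 : -1 <= a <= 1.
  by rewrite -ler_norml -sqrtr_sqr -sqrtr1 ler_wsqrtr // -ab lerDl sqr_ge0.
have aK : cos (acos a) = a by rewrite acosK.
have sE : sin (acos a) = `|b|.
  by rewrite sin_acos // -ab addrC addKr sqrtr_sqr.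
have g0 := acos_ge0 a1; have lp := acos_lepi a1.
have [b0|b0] := leP 0 b.
  exists (acos a); last by rewrite aK sE ger0_norm.
  by rewrite g0 /=; lra.
exists (2 * pi - acos a).
  have /andP[a1' a1''] := a1.
  have : a < 1.
    rewrite lt_neqAle a1'' andbT; apply/eqP => a1E; move: ab b0; rewrite a1E.
    move=> /eqP; rewrite expr1n -subr_eq0 addrAC subrr add0r sqrf_eq0.
    by move=> /eqP ->; rewrite ltxx.
  move=> alt; have : 0 < acos a by apply: acos_gt0; rewrite a1'.
  by lra.
by rewrite mulr_natl cosB sinB cos2pi sin2pi aK sE ltr0_norm //; split; ring.
Qed.

Lemma expC_twopii_surj (z : C) : z != 0 ->
  exists2 x : C, 0 <= complex.Re x < 1 & expC (twopii R * x) = z.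
Proof.
case: z => a b z0; have pi0 := pi_gt0 R; set r := Num.sqrt (a ^+ 2 + b ^+ 2).
have r2 : r ^+ 2 = a ^+ 2 + b ^+ 2 by rewrite sqr_sqrtr ?addr_ge0 ?sqr_ge0.
have r0 : 0 < r.
  rewrite sqrtr_gt0 lt_neqAle addr_ge0 ?sqr_ge0 // andbT eq_sym.
  rewrite paddr_eq0 ?sqr_ge0 // !sqrf_eq0.
  apply: contra z0 => /andP[/eqP -> /eqP ->].
  by rewrite eq_complex /= !eqxx.
have [|t /andP[t0 t1] [ct st]] := @cos_sin_surj (a / r) (b / r).
  by rewrite !expr_div_n -mulrDl -r2 divff // expf_neq0 // gt_eqF.
exists ((t / (2 * pi)) +i* (- (ln r / (2 * pi)))) => /=.
  have p20 : 0 < 2 * pi :> R by rewrite mulr_gt0.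
  by rewrite divr_ge0 ?(ltW p20) //= ltr_pdivrMr // mul1r.
rewrite expC_twopii.
have pin : pi != 0 :> R by rewrite gt_eqF.
have rn : r != 0 by rewrite gt_eqF.
have -> : 2 * pi * (t / (2 * pi)) = t by rewrite mulrC divfK // mulf_neq0.
have -> : - (2 * pi * (- (ln r / (2 * pi)))) = ln r.
  by rewrite mulrN opprK mulrC divfK // mulf_neq0.
rewrite lnK ?posrE // ct st; apply/eqP; rewrite eq_complex /=; apply/andP.
by split; apply/eqP; field.
Qed.

End ComplexExp.

(** * Polynomials in an operator and generalized eigenspaces *)

Section PolyAction.
Variables (F : fieldType) (V : lmodType F) (g : {linear V -> V}).
Implicit Types (p q : {poly F}) (v w : V).

(** The action of [F[X]] on [V] in which ['X] acts as [g]. *)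
Definition polyop p v : V := \sum_(i < size p) p`_i *: iter i g v.

Lemma polyop_widen n p v : (size p <= n)%N ->
  polyop p v = \sum_(i < n) p`_i *: iter i g v.
Proof.
move=> le_pn; rewrite /polyop (big_ord_widen n (fun i => p`_i *: iter i g v)) //.
rewrite big_mkcond; apply: eq_bigr => i _; case: ltnP => // le_pi.
by rewrite nth_default // scale0r.
Qed.

Lemma iter_linear n : linear (iter n g).
Proof. by elim: n => // n IH a u v; rewrite /= IH linearP. Qed.
HB.instance Definition _ n :=
  GRing.isLinear.Build F V V *:%R (iter n g) (iter_linear n).

Lemma polyop_linear p : linear (polyop p).
Proof.
move=> a u v; rewrite /polyop scaler_sumr -big_split; apply: eq_bigr => i _ /=.
by rewrite iter_linear scalerDr !scalerA mulrC.
Qed.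
HB.instance Definition _ p :=
  GRing.isLinear.Build F V V *:%R (polyop p) (polyop_linear p).

Lemma polyopD p q v : polyop (p + q) v = polyop p v + polyop q v.
Proof.
pose n := maxn (size p) (size q).
rewrite !(@polyop_widen n) ?leq_maxl ?leq_maxr ?size_polyD // -big_split.
by apply: eq_bigr => i _; rewrite coefD scalerDl.
Qed.

Lemma polyopC c v : polyop c%:P v = c *: v.
Proof.
by rewrite (@polyop_widen 1) ?size_polyC ?leq_b1 // big_ord1 coefC eqxx.
Qed.

Lemma polyop0 v : polyop 0 v = 0.
Proof. by rewrite -[0 in LHS]/(0%:P) polyopC scale0r. Qed.

Lemma polyopZ c p v : polyop (c *: p) v = c *: polyop p v.
Proof.
rewrite (polyop_widen _ (size_scale_leq c p)) scaler_sumr.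
by apply: eq_bigr => i _; rewrite coefZ scalerA.
Qed.

Lemma polyop1 v : polyop 1 v = v.
Proof. by rewrite -[1]/(1%:P) polyopC scale1r. Qed.

Lemma polyop_mulX p v : polyop (p * 'X) v = polyop p (g v).
Proof.
have le_pX : (size (p * 'X)%R <= (size p).+1)%N.
  have [->|p0] := eqVneq p 0; first by rewrite mul0r size_poly0.
  by rewrite size_mulX.
rewrite (polyop_widen _ le_pX) big_ord_recl coefMX eqxx scale0r add0r.
by apply: eq_bigr => i _; rewrite coefMX lift0 /= -iterS iterSr.
Qed.

Lemma polyop_comm p v : polyop p (g v) = g (polyop p v).
Proof.
by rewrite [RHS]linear_sum; apply: eq_bigr => i _; rewrite linearZ -iterSr.
Qed.

Lemma polyopM p q v : polyop (p * q) v = polyop p (polyop q v).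
Proof.
elim/poly_ind: p q v => [|p c IH] q v; first by rewrite mul0r !polyop0.
rewrite mulrDl !polyopD mul_polyC polyopZ polyopC -mulrA -commr_polyX.
by rewrite IH !polyop_mulX polyop_comm.
Qed.

Lemma polyop_stable (W : set V) p v :
  (forall a u w, W u -> W w -> W (a *: u + w)) -> (forall u, W u -> W (g u)) ->
  W v -> W (polyop p v).
Proof.
move=> Wlin Wg Wv.
have W0 : W 0 by rewrite -(addNr v) -scaleN1r; apply: Wlin.
apply: (big_ind W) => // [u w Wu Ww|i _].
  by rewrite -[u]scale1r; apply: Wlin.
by rewrite -[_ *: _]addr0; apply: Wlin => //; elim: (val i) => //= k /Wg.
Qed.

Lemma polyop_XsubC_exp l k v :
  polyop (('X - l%:P) ^+ k) v = iter k (fun w => g w - l *: w) v.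
Proof.
elim: k v => [|k IH] v; first by rewrite expr0 polyop1.
rewrite exprSr polyopM IH iterSr -[X in X - _]mul1r -polyCN; congr (iter k _ _).
by rewrite polyopD polyop_mulX polyop1 polyopC scaleNr.
Qed.

Definition gen_eigen l : set V :=
  [set v | exists k, polyop (('X - l%:P) ^+ k) v = 0].

Lemma dvdp_polyop_eq0 p q v : p %| q -> polyop p v = 0 -> polyop q v = 0.
Proof. by case/dvdpP => r -> pv; rewrite polyopM pv linear0. Qed.

Lemma gen_eigen_le l k m v : (k <= m)%N ->
  polyop (('X - l%:P) ^+ k) v = 0 -> polyop (('X - l%:P) ^+ m) v = 0.
Proof. by move=> le_km; apply/dvdp_polyop_eq0/dvdp_exp2l. Qed.

Lemma gen_eigen_lin l a u v : gen_eigen l u -> gen_eigen l v ->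
  gen_eigen l (a *: u + v).
Proof.
move=> [k ku] [m mv]; exists (maxn k m); rewrite linearP /=.
by rewrite (gen_eigen_le (leq_maxl k m) ku) (gen_eigen_le (leq_maxr k m) mv)
  scaler0 addr0.
Qed.

Lemma gen_eigen0 l : gen_eigen l 0.
Proof. by exists 0%N; rewrite linear0. Qed.

Lemma gen_eigenD l u v : gen_eigen l u -> gen_eigen l v -> gen_eigen l (u + v).
Proof. by move=> ul vl; rewrite -[u]scale1r; apply: gen_eigen_lin. Qed.

Lemma gen_eigen_polyop l p v : gen_eigen l v -> gen_eigen l (polyop p v).
Proof. by move=> [k kv]; exists k; rewrite -polyopM mulrC polyopM kv linear0. Qed.

Lemma gen_eigen_stable l v : gen_eigen l v -> gen_eigen l (g v).
Proof.
by move=> lv; rewrite -[g v]polyop1 -polyop_mulX; apply: gen_eigen_polyop.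
Qed.

(** The last nonzero vector among the [(g - l)^k v] is an eigenvector. *)
Lemma gen_eigen_eigenvector l v : gen_eigen l v -> v != 0 ->
  exists2 w, w != 0 & g w = l *: w.
Proof.
case=> k; rewrite polyop_XsubC_exp => kv v0.
elim: k v kv v0 => [|k IH] v; first by move=> /= ->; rewrite eqxx.
rewrite iterSr => kv v0; have [E|] := eqVneq (g v - l *: v) 0.
  by exists v => //; apply/eqP; rewrite -subr_eq0 E.
exact: IH kv.
Qed.

(** Hermite interpolation with locally constant data: the moduli are powers of
pairwise distinct linear factors, so the Chinese remainder theorem applies. *)
Lemma poly_interp (s : seq F) (N : nat) (f : F -> F) :
  exists p, forall l, l \in s -> ('X - l%:P) ^+ N %| p - (f l)%:P.
Proof.
elim: s => [|l s [p ps]]; first by exists 0.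
have [l_s|l_s] := boolP (l \in s).
  by exists p => m; rewrite inE => /predU1P[->|]; apply: ps.
pose Q := \prod_(m <- s) ('X - m%:P) ^+ N.
have : coprimep Q (('X - l%:P) ^+ N).
  apply: coprimep_expr; rewrite coprimep_XsubC /root horner_prod.
  rewrite prodf_seq_neq0; apply/allP => m ms /=; rewrite hornerE hornerXsubC.
  by rewrite expf_neq0 // subr_eq0; apply: contraNneq l_s => ->.
case/Bezout_eq1_coprimepP => -[u w] /= uw.
(* [u * Q] is 0 modulo the earlier moduli and 1 modulo the new one. *)
exists (p + u * Q * ((f l)%:P - p)) => m; rewrite inE => /predU1P[->|ms].
  have -> : p + u * Q * ((f l)%:P - p) - (f l)%:P =
      w * ('X - l%:P) ^+ N * (p - (f l)%:P).
    rewrite -[w * _](addKr (u * Q)) uw; ring.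
  by apply: dvdp_mulr; apply: dvdp_mull.
rewrite addrAC; apply: dvdp_add; first exact: ps.
apply: dvdp_mulr; apply: dvdp_mull.
by rewrite /Q (big_rem m ms) /=; apply: dvdp_mulr.
Qed.

(** The graph of the operator acting as [f l] on the generalized eigenspace of
[l]. Eigenvalues may repeat in the list, which makes the graph visibly a
linear subspace; that it is single-valued is [spectral_rel_uniq]. *)
Definition spectral_rel (f : F -> F) v w : Prop := exists s : seq (F * V),
  [/\ forall x, x \in s -> gen_eigen x.1 x.2, v = \sum_(x <- s) x.2 &
      w = \sum_(x <- s) f x.1 *: x.2].

Lemma spectral_rel1 f l v : gen_eigen l v -> spectral_rel f v (f l *: v).
Proof.
move=> lv; exists [:: (l, v)]; rewrite !big_seq1; split=> // x.
by rewrite inE => /eqP ->.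
Qed.

Lemma spectral_rel_lin f a v w v' w' :
  spectral_rel f v w -> spectral_rel f v' w' ->
  spectral_rel f (a *: v + v') (a *: w + w').
Proof.
move=> [s [sE -> ->]] [s' [s'E -> ->]].
exists ([seq (x.1, a *: x.2) | x <- s] ++ s'); split.
- move=> x; rewrite mem_cat => /orP[/mapP[y ys ->]|/s'E //] /=.
  by rewrite -[_ *: _]addr0; apply: gen_eigen_lin (gen_eigen0 _); apply: sE.
- by rewrite big_cat big_map scaler_sumr.
- rewrite big_cat big_map scaler_sumr; congr (_ + _).
  by apply: eq_bigr => x _ /=; rewrite !scalerA mulrC.
Qed.

Lemma spectral_rel0 f : spectral_rel f 0 0.
Proof. by exists [::]; rewrite !big_nil; split. Qed.

Lemma spectral_rel_sum f (I : eqType) (r : seq I) (a b : I -> V) :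
  (forall i, i \in r -> spectral_rel f (a i) (b i)) ->
  spectral_rel f (\sum_(i <- r) a i) (\sum_(i <- r) b i).
Proof.
elim: r => [|i r IH] ab; first by rewrite !big_nil; apply: spectral_rel0.
rewrite !big_cons -[a i]scale1r -[b i]scale1r; apply: spectral_rel_lin.
  by apply: ab; rewrite mem_head.
by apply: IH => j jr; apply: ab; rewrite inE jr orbT.
Qed.

(** The polynomial depends on [v], but one that takes the value [f l] to high
order at each eigenvalue [l] occurring in [v] does the job. *)
Lemma spectral_rel_polyop f v w : spectral_rel f v w -> exists p, w = polyop p v.
Proof.
case=> s [sE -> ->].
have [N Ns] : exists N, forall x, x \in s -> polyop (('X - x.1%:P) ^+ N) x.2 = 0.
  elim: s sE => [|x s IH] sE; first by exists 0%N.
  have [|N Ns] := IH; first by move=> y ys; apply: sE; rewrite inE ys orbT.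
  have [|k kx] := sE x; first by rewrite mem_head.
  exists (maxn N k) => y; rewrite inE => /predU1P[->|/Ns]; apply: gen_eigen_le.
  - exact: leq_maxr.
  - exact: kx.
  - exact: leq_maxl.
have [p ps] := poly_interp [seq x.1 | x <- s] N f.
exists p; rewrite linear_sum /= big_seq [RHS]big_seq; apply: eq_bigr => x xs.
have /dvdp_polyop_eq0/(_ (Ns x xs)) := ps _ (map_f _ xs).
by rewrite polyopD -polyCN polyopC scaleNr => /eqP; rewrite subr_eq0 => /eqP.
Qed.

(** By linearity it suffices that [0] is related only to [0], and a polynomial
in [g] sends [0] to [0]. *)
Lemma spectral_rel_uniq f v w w' :
  spectral_rel f v w -> spectral_rel f v w' -> w = w'.
Proof.
move=> vw vw'; have /spectral_rel_polyop[p] := spectral_rel_lin (-1) vw vw'.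
by rewrite !scaleN1r addNr linear0 addrC => /eqP; rewrite subr_eq0 => /eqP.
Qed.

Lemma spectral_rel_comp f h v w : spectral_rel f v w ->
  forall w', spectral_rel (fun l => h l * f l) v w' ->
  spectral_rel h w w'.
Proof.
move=> [s [sE -> ->]] w' vw'.
have -> : w' = \sum_(x <- s) h x.1 *: (f x.1 *: x.2).
  apply: spectral_rel_uniq vw' _; exists s; split=> //.
  by apply: eq_bigr => x _; rewrite scalerA.
apply: spectral_rel_sum => x xs; apply: spectral_rel1; rewrite -polyopC.
exact/gen_eigen_polyop/sE.
Qed.

End PolyAction.

Section Decomposition.
Variables (F : closedFieldType) (V : lmodType F) (g : {linear V -> V}).

(** If [l] is a root of the annihilator, write it [q ('X - l)^m] with coprime
factors: a Bezout relation splits [v] into a part killed by [('X - l)^m] and a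
part killed by [q], to which the induction applies. *)
Lemma gen_eigen_decomp (p : {poly F}) (v : V) : p != 0 -> polyop g p v = 0 ->
  exists s : seq (F * V),
    (forall x, x \in s -> gen_eigen g x.1 x.2) /\ v = \sum_(x <- s) x.2.
Proof.
have [n le_pn] := ubnP (size p); elim: n p le_pn v => // n IH p le_pn v p0 pv.
have [sp1|/closed_rootP[l lp]] := eqVneq (size p) 1.
  have [c c0 pE] : exists2 c, c != 0 & p = c%:P by apply/size_poly1P/eqP.
  exists [::]; split=> //; rewrite big_nil; apply/eqP.
  by move: pv; rewrite pE polyopC => /eqP; rewrite scaler_eq0 (negPf c0).
have [m [q]] := multiplicity_XsubC p l; rewrite p0 /= => lq pE.
have : coprimep q (('X - l%:P) ^+ m).
  by apply: coprimep_expr; rewrite coprimep_XsubC.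
case/Bezout_eq1_coprimepP => -[a b] /= ab.
have q0 : q != 0 by apply: contraNneq p0 => q0; rewrite pE q0 mul0r.
have m0 : (0 < m)%N.
  by rewrite lt0n; apply: contraTneq lp => m0; rewrite pE m0 expr0 mulr1.
have [||s [sE vE]] := IH q _ (polyop g (b * ('X - l%:P) ^+ m) v) q0.
- rewrite -ltnS; apply: leq_trans le_pn; rewrite ltnS pE.
  rewrite size_mul ?expf_neq0 ?polyXsubC_eq0 // size_exp_XsubC.
  by rewrite addnS /= -addn1 leq_add2l.
- by rewrite -polyopM mulrCA -pE polyopM pv linear0.
(* As [a q + b ('X - l)^m = 1], the two components below add up to [v]. *)
exists ((l, polyop g (a * q) v) :: s); split.
  move=> x; rewrite inE => /predU1P[->|/sE //]; exists m => /=.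
  by rewrite -polyopM mulrCA [_ ^+ _ * _]mulrC -pE polyopM pv linear0.
by rewrite big_cons -vE -polyopD ab polyop1.
Qed.

End Decomposition.

Section Spectral.
Variables (F : closedFieldType) (V : lmodType F) (g : {linear V -> V}).
Hypothesis locfin : forall v : V, exists2 p, p != 0 & polyop g p v = 0.

Definition spectral_op (f : F -> F) (v : V) : V :=
  xget 0 [set w | spectral_rel g f v w].

Lemma spectral_opP f v : spectral_rel g f v (spectral_op f v).
Proof.
apply: (@xgetPex _ 0 [set w | spectral_rel g f v w]).
have [p p0 /(gen_eigen_decomp p0)[s [sE ->]]] := locfin v.
by exists (\sum_(x <- s) f x.1 *: x.2); exists s.
Qed.

Lemma spectral_opE f v w : spectral_rel g f v w -> spectral_op f v = w.
Proof. exact/spectral_rel_uniq/spectral_opP. Qed.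

Lemma spectral_op_linear f : linear (spectral_op f).
Proof.
by move=> a u v; apply: spectral_opE; apply: spectral_rel_lin;
  apply: spectral_opP.
Qed.

Lemma spectral_op_gen_eigen f l v : gen_eigen g l v -> spectral_op f v = f l *: v.
Proof. by move=> lv; apply/spectral_opE/spectral_rel1. Qed.

End Spectral.

(** * Finite-dimensional weight spaces and weakly convergent sums *)

Section FiniteDim.
Variables (F : fieldType) (V : lmodType F).

(** The iterates of [v] up to the [size s]-th outnumber the spanning vectors, so
they are linearly dependent. *)
Lemma findim_annihilator (g : {linear V -> V}) (s : seq V) (v : V) :
  (forall k, exists c : nat -> F, iter k g v = \sum_(i < size s) c i *: s`_i) ->
  exists2 p, p != 0 & polyop g p v = 0.
Proof.
move=> sp; set m := size s.
have [c cE] := choice sp.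
pose M := \matrix_(k < m.+1, i < m) c k i.
have : kermx M != 0.
  by rewrite -mxrank_eq0 mxrank_ker subn_eq0 -ltnNge ltnS rank_leq_col.
case/rowV0Pn => x /sub_kermxP xM x0.
pose p : {poly F} := \poly_(k < m.+1) x 0 (inord k).
exists p.
  apply: contraNneq x0 => p0; apply/eqP/rowP => k; rewrite mxE.
  have := congr1 (fun q : {poly F} => q`_k) p0.
  by rewrite /= coef_poly ltn_ord inord_val coef0.
rewrite (polyop_widen _ _ (size_poly _ _)).
transitivity (\sum_(k < m.+1) \sum_(i < m) (x 0 k * M k i) *: s`_i).
  apply: eq_bigr => k _; rewrite coef_poly ltn_ord inord_val cE scaler_sumr.
  by apply: eq_bigr => i _; rewrite mxE scalerA.
rewrite exchange_big big1 // => i _; rewrite -scaler_suml.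
by have := congr1 (fun y : 'rV_m => y 0 i) xM; rewrite !mxE => ->; rewrite scale0r.
Qed.

Lemma sum_annihilator (g : {linear V -> V}) (I : Type) (r : seq I) (v : I -> V) :
  (forall i, exists2 p, p != 0 & polyop g p (v i) = 0) ->
  exists2 p, p != 0 & polyop g p (\sum_(i <- r) v i) = 0.
Proof.
move=> ann; elim: r => [|i r [p p0 pr]].
  by exists 1; rewrite ?oner_neq0 // big_nil linear0.
have [q q0 qi] := ann i.
exists (p * q); first by rewrite mulf_neq0.
by rewrite big_cons linearD /= polyopM qi linear0 add0r mulrC polyopM pr linear0.
Qed.

(** A nontrivial relation lets one spanning vector be dropped, so a free family
is reached by descent on the size. *)
Lemma minimal_span (P : V -> V) (n : nat) (e : 'I_n -> V) :
  (forall v, exists c, P v = \sum_i c i *: e i) ->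
  exists m (b : 'I_m -> V), (forall v, exists c, P v = \sum_i c i *: b i) /\
    (forall c, \sum_i c i *: b i = 0 -> forall i, c i = 0).
Proof.
elim: n e => [|n IH] e sp; first by exists 0%N, e; split=> // c _ [].
have [free|] := pselect (forall c, \sum_i c i *: e i = 0 -> forall i, c i = 0).
  by exists n.+1, e.
move/existsNP => [c /not_implyP[c0 /existsNP[j /eqP cj]]].
apply: (IH (e \o lift j)) => v; have [a ->] := sp v.
(* The relation [c] eliminates [e j]. *)
exists (fun i => a (lift j i) - a j / c j * c (lift j i)).
transitivity (\sum_i (a i - a j / c j * c i) *: e i).
  under [RHS]eq_bigr do rewrite scalerBl -scalerA.
  by rewrite sumrB -scaler_sumr c0 scaler0 subr0.
by rewrite (bigD1_ord j) //= divfK // subrr scale0r add0r.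
Qed.

(** The coordinates of [P v] in a free spanning family of the image of [P] are
linear forms in [v]; composing with [P] is what defines them on the whole of
[V], and in the application [P] is the projection onto a weight space. *)
Lemma separating_form (P : {linear V -> V}) (s : seq V) (w : V) :
  (forall v, exists c : nat -> F, P v = \sum_(i < size s) c i *: s`_i) ->
  P w != 0 ->
  exists2 phi : {scalar V}, (forall v, P v = 0 -> phi v = 0) & phi w != 0.
Proof.
move=> sp Pw.
have [|m [b [bspan bfree]]] := @minimal_span P _ (fun i : 'I_(size s) => s`_i).
  by move=> v; have [c ->] := sp v; exists (fun i : 'I_(size s) => c i).
have [x xE] := choice bspan.
have x_uniq v c : P v = \sum_i c i *: b i -> x v = c.
  move=> vc; apply/funext => i; apply/eqP; rewrite -subr_eq0; apply/eqP.
  apply: (bfree (fun i => x v i - c i)).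
  rewrite (eq_bigr _ (fun i _ => scalerBl _ _ _)).
  by rewrite sumrB -xE -vc subrr.
have x_lin i : scalar (fun v => x v i).
  move=> a u v; rewrite (x_uniq _ (fun i => a * x u i + x v i)) //.
  rewrite linearP /= !xE scaler_sumr -big_split; apply: eq_bigr => j _.
  by rewrite scalerDl scalerA.
have [i xi] : exists i, x w i != 0.
  apply: contrapT => /forallNP x0; move/eqP: Pw; apply; rewrite xE big1 // => i _.
  by have /negP := x0 i; rewrite negbK => /eqP ->; rewrite scale0r.
pose phi : {scalar V} := HB.pack (fun v => x v i)
  (GRing.isLinear.Build _ _ _ _ (fun v => x v i) (x_lin i)).
exists phi => // v Pv /=; rewrite (x_uniq _ (fun=> 0)) //.
by rewrite Pv big1 // => j _; rewrite scale0r.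
Qed.

End FiniteDim.

Section WeakSums.
Variables (R : realType) (V : lmodType R[i]) (A : gr_vertex_superalgebra V).
Local Notation C := R[i].

Lemma gv_pr_wtspace k v : wtspace (gv_pr A) k (gv_pr A k v).
Proof. by have [prE _ _] := gv_grading A; rewrite /wtspace /= prE eqxx. Qed.

Lemma graded_dual_sep (v w : V) :
  (forall phi : {scalar V}, graded_dual (gv_pr A) phi -> phi v = phi w) -> v = w.
Proof.
move=> vw; have [prE prfin prsum] := gv_grading A.
apply: contrapT => /eqP; rewrite -subr_eq0 => vw0.
have [k kvw] : exists k, gv_pr A k (v - w) != 0.
  apply: contrapT => /forallNP pr0; move/eqP: vw0; apply.
  rewrite (prsum (v - w)) fsbig1 // => k _.
  by have /negP := pr0 k; rewrite negbK => /eqP.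
have [s sp] := gv_findim A k.
have [u|phi phi0] := separating_form (s := s) _ kvw.
  exact/sp/gv_pr_wtspace.
rewrite linearB /= vw ?subrr ?eqxx //.
apply: (@sub_finite_set _ _ [set k]); last exact: finite_set1.
move=> l /= [u /eqP phiu]; apply: contrapT => /eqP lk; apply: phiu; apply: phi0.
by rewrite prE eq_sym (negPf lk).
Qed.

(** The limits of the scalar series determine the sum since the graded dual
separates points. *)
Lemma vsumE (a : nat -> V) (w : V) :
  (forall phi : {scalar V}, graded_dual (gv_pr A) phi ->
    (fun n : nat => \sum_(k < n) phi (a k) : C^o) @ \oo --> (phi w : C^o)) ->
  vsum A a = w.
Proof.
move=> cv; apply: xget_unique => // w' cv'; apply: graded_dual_sep => phi gphi.
exact: cvg_unique (cv' phi gphi) (cv phi gphi).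
Qed.

Lemma vsum_finite (a : nat -> V) (n : nat) :
  (forall k, (n <= k)%N -> a k = 0) -> vsum A a = \sum_(k < n) a k.
Proof.
move=> a0; apply: vsumE => phi _; apply: cvg_near_cst.
exists n => // m /= le_nm; rewrite linear_sum /=.
rewrite -!(big_mkord xpredT (fun k => phi (a k))).
rewrite (big_cat_nat _ (n := n)) //= [X in _ + X]big_nat_cond.
rewrite [X in _ + X]big1 ?addr0 // => k.
by rewrite andbT => /andP[nk _]; rewrite a0 // linear0.
Qed.

Lemma locally_finite (g : {linear V -> V}) :
  (forall k v, wtspace (gv_pr A) k v -> wtspace (gv_pr A) k (g v)) ->
  forall v, exists2 p, p != 0 & polyop g p v = 0.
Proof.
move=> gwt v; have [_ prfin prsum] := gv_grading A.
rewrite (prsum v); apply: sum_annihilator => k.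
have [s sp] := gv_findim A k.
apply: (findim_annihilator (s := s)) => j; apply: sp.
by elim: j => [|j IH]; [exact: gv_pr_wtspace | exact: gwt].
Qed.

End WeakSums.

(** * Logarithms and exponentials of locally nilpotent operators *)

Section LocallyNilpotent.
Variables (F : numFieldType) (V : lmodType F).
Implicit Types (D U : {linear V -> V}) (u v w : V).

Lemma iter_eq0_le D m n v : (m <= n)%N -> iter m D v = 0 -> iter n D v = 0.
Proof.
move=> le_mn mv; rewrite -(subnK le_mn) iterD mv.
by elim: (n - m)%N => //= k ->; rewrite linear0.
Qed.

Definition exp_trunc D (t : F) (n : nat) v : V :=
  \sum_(k < n) (t ^+ k / k`!%:R) *: iter k D v.

Lemma exp_trunc_lin D t n : linear (exp_trunc D t n).
Proof.
move=> a u v; rewrite /exp_trunc scaler_sumr -big_split; apply: eq_bigr => k _.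
by rewrite /= iter_linear scalerDr !scalerA mulrC.
Qed.
HB.instance Definition _ D t n := GRing.isLinear.Build F V V *:%R
  (exp_trunc D t n) (exp_trunc_lin D t n).

Lemma exp_trunc_add D s t n v : iter n D v = 0 ->
  exp_trunc D s n (exp_trunc D t n v) = exp_trunc D (s + t) n v.
Proof.
move=> nv.
pose G i j := (s ^+ i / i`!%:R * (t ^+ j / j`!%:R)) *: iter (i + j) D v.
transitivity (\sum_(k < n) \sum_(i < k.+1) G i (k - i)%N); last first.
  apply: eq_bigr => k _; rewrite /G.
  under eq_bigr => i _ do rewrite subnKC -1?ltnS //.
  rewrite -scaler_suml; congr (_ *: _); rewrite addrC exprDn mulr_suml.
  apply: eq_bigr => i _;
  rewrite -[_ *+ 'C(_, _)]mulr_natr -!mulrA bin_divfact -1?ltnS //.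
  by field; rewrite !fact_neq0.
rewrite triangle_sum; apply: eq_bigr => i _.
have -> : iter i D (exp_trunc D t n v) =
    \sum_(j < n) (t ^+ j / j`!%:R) *: iter (i + j) D v.
  by rewrite linear_sum; apply: eq_bigr => j _; rewrite linearZ /= iterD.
rewrite scaler_sumr [RHS]big_mkcond; apply: eq_bigr => j _; rewrite scalerA.
by case: leqP => //= nij; rewrite (iter_eq0_le nij nv) scaler0.
Qed.

Lemma exp_trunc0 D n v : (0 < n)%N -> exp_trunc D 0 n v = v.
Proof.
case: n => // n _; rewrite /exp_trunc big_ord_recl big1 => [|i _].
  by rewrite expr0 divr1 scale1r addr0.
by rewrite lift0 expr0n mul0r scale0r.
Qed.

Section Derivation.
Variables (B : {bilinear V -> V -> V}) (D : {linear V -> V}).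
Hypothesis DB : forall u v, D (B u v) = B (D u) v + B u (D v).

Let E k v := (k`!%:R)^-1 *: iter k D v.

Let ES k v : D (E k v) = k.+1%:R *: E k.+1 v.
Proof.
by rewrite /E linearZ /= scalerA factS natrM invfM mulrA divff ?mul1r // pnatr_eq0.
Qed.

(** Divided powers satisfy [D E_k = (k + 1) E_(k+1)]; the induction multiplies
by [k + 1] and splits that factor as [i + (k + 1 - i)] in the [i]-th term. *)
Lemma divided_leibniz k u v :
  (k`!%:R)^-1 *: iter k D (B u v) =
  \sum_(i < k.+1) B ((i`!%:R)^-1 *: iter i D u)
                    (((k - i)`!%:R)^-1 *: iter (k - i) D v).
Proof.
rewrite -/(E k (B u v)); elim: k => [|k IH].
  by rewrite big_ord1 /E /= !invr1 !scale1r.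
have k0 : (k.+1%:R : F) != 0 by rewrite pnatr_eq0.
apply: (scalerI k0); rewrite -ES IH linear_sum scaler_sumr /=.
under eq_bigr => i _ do rewrite DB -/(E i u) -/(E (k - i)%N v) !ES
  linearZl_LR [X in _ + X]linearZr_LR /=.
rewrite big_split /=.
have kE (i : 'I_k.+2) : k.+1%:R = i%:R + (k.+1 - i)%:R :> F.
  by rewrite -natrD subnKC -1?ltnS.
under [RHS]eq_bigr => i _ do
  rewrite -/(E i u) -/(E (k.+1 - i)%N v) (kE i) scalerDl.
rewrite big_split /=; congr (_ + _).
  rewrite [RHS]big_ord_recl scale0r add0r; apply: eq_bigr => i _.
  by rewrite lift0 subSS.
rewrite [RHS]big_ord_recr /= subnn scale0r addr0; apply: eq_bigr => i _.
by rewrite subSn // -ltnS.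
Qed.

(** The order [n + n] makes every term above the diagonal of the product vanish:
one of its two indices is at least [n]. *)
Lemma exp_trunc_mult t n u v : iter n D u = 0 -> iter n D v = 0 ->
  exp_trunc D t (n + n) (B u v) =
  B (exp_trunc D t (n + n) u) (exp_trunc D t (n + n) v).
Proof.
move=> nu nv.
pose G i j :=
  B ((t ^+ i / i`!%:R) *: iter i D u) ((t ^+ j / j`!%:R) *: iter j D v).
transitivity (\sum_(k < n + n) \sum_(i < k.+1) G i (k - i)%N).
  apply: eq_bigr => k _; rewrite -scalerA divided_leibniz scaler_sumr.
  apply: eq_bigr => i _; rewrite /G -!scalerA.
  rewrite [in RHS]linearZl_LR [in RHS]linearZr_LR scalerA -exprD subnKC //.
  by rewrite -ltnS.
rewrite triangle_sum /exp_trunc linear_sumlz; apply: eq_bigr => i _.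
rewrite linear_sum [LHS]big_mkcond; apply: eq_bigr => j _.
case: leqP => //= nij; rewrite -/(G i j) /G.
have [ni|ni] := leqP n i.
  by rewrite (iter_eq0_le ni nu) scaler0 linear0l.
have [nj|nj] := leqP n j.
  by rewrite (iter_eq0_le nj nv) scaler0 linear0r.
by move: nij; rewrite leqNgt -addSn leq_add // ltnW.
Qed.

End Derivation.

(** The Vandermonde matrix of [0, ..., N - 1] is invertible in characteristic
zero. *)
Lemma coef_from_values (N k : nat) : (k < N)%N -> exists c : nat -> F,
  forall p : {poly F}, (size p <= N)%N -> p`_k = \sum_(n < N) c n * p.[n%:R].
Proof.
move=> kN; pose M := Vandermonde N (\row_(j < N) (j%:R : F)).
have Mu : M \in unitmx.
  rewrite unitmxE det_Vandermonde unitfE; apply/prodf_neq0 => i _.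
  apply/prodf_neq0 => j ij; rewrite !mxE subr_eq0 eqr_nat.
  by rewrite neq_ltn ij orbT.
exists (fun n => if insub n is Some n' then (invmx M) n' (Ordinal kN) else 0).
move=> p sp.
pose r : 'rV_N := \row_i p`_i.
have -> : p`_k = (r *m M *m invmx M) 0 (Ordinal kN).
  by rewrite mulmxK // mxE.
rewrite mxE; apply: eq_bigr => n _; rewrite valK mulrC; congr (_ * _).
rewrite (horner_coef_wide _ sp) mxE; apply: eq_bigr => i _.
by rewrite !mxE.
Qed.

(** Vector-valued polynomials that agree at all natural numbers have equal
coefficients; they are written here as combinations of scalar polynomials. *)
Lemma eq_vector_poly_coef (I J : finType) (p : I -> {poly F}) (q : J -> {poly F})
    (w : I -> V) (z : J -> V) (k : nat) :
  (forall n : nat, \sum_i (p i).[n%:R] *: w i = \sum_j (q j).[n%:R] *: z j) ->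
  \sum_i (p i)`_k *: w i = \sum_j (q j)`_k *: z j.
Proof.
move=> pq.
pose N := (k + \sum_i size (p i) + \sum_j size (q j)).+1%N.
have kN : (k < N)%N by rewrite ltnS -addnA leq_addr.
have [c cE] := coef_from_values kN.
have sp i : (size (p i) <= N)%N.
  by rewrite /N (bigD1 i) //= leqW // addnAC addnCA leq_addr.
have sq j : (size (q j) <= N)%N.
  by rewrite /N (bigD1 j) //= leqW // addnCA leq_addr.
transitivity (\sum_(n < N) c n *: \sum_i (p i).[n%:R] *: w i).
  under [RHS]eq_bigr do rewrite scaler_sumr.
  rewrite exchange_big; apply: eq_bigr => i _; rewrite cE // scaler_suml.
  by apply: eq_bigr => n _; rewrite scalerA.
under eq_bigr do rewrite pq scaler_sumr.
rewrite exchange_big; apply: eq_bigr => i _; rewrite cE // scaler_suml.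
by apply: eq_bigr => n _; rewrite scalerA.
Qed.

(** The polynomial ['C(X, j)]. *)
Definition bin_poly (j : nat) : {poly F} :=
  (j`!%:R)^-1 *: \prod_(i < j) ('X - (i%:R)%:P).

Lemma bin_poly_nat j n : (bin_poly j).[n%:R] = 'C(n, j)%:R.
Proof.
have -> : 'C(n, j)%:R = (n ^_ j)%:R / (j`!)%:R :> F.
  by rewrite -bin_ffact natrM mulfK // fact_neq0.
rewrite hornerZ mulrC horner_prod; congr (_ / _).
rewrite ffact_prod natr_prod; have [jn|nj] := leqP j n.
  apply: eq_bigr => i _; rewrite hornerXsubC natrB //.
  exact: leq_trans (ltnW (ltn_ord i)) jn.
rewrite (bigD1 (Ordinal nj)) //= hornerXsubC subrr mul0r.
by rewrite (bigD1 (Ordinal nj)) //= subnn mul0r.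
Qed.

Lemma bin_poly_coef0 j : (bin_poly j)`_0 = (j == 0)%:R.
Proof. by rewrite -horner_coef0 -[0]/(0%:R) bin_poly_nat bin0n. Qed.

(** These are the coefficients of the power series of [log (1 + x)], because
[log (1 + x)] is the coefficient of [t] in [(1 + x)^t]. *)
Lemma bin_poly_coef1 j : (bin_poly j.+1)`_1 = (-1) ^+ j / j.+1%:R.
Proof.
rewrite coefZ big_ord_recl /= polyC0 subr0 coefXM /=.
rewrite -horner_coef0 horner_prod.
have -> : \prod_(i < j) ('X - ((bump 0 i)%:R)%:P : {poly F}).[0] =
    (-1) ^+ j * j`!%:R.
  elim: j => [|j IH]; first by rewrite big_ord0 mulr1.
  rewrite big_ord_recr /= IH hornerXsubC sub0r exprS factS natrM /bump leq0n.
  by rewrite mulrN mulN1r mulNr -mulrA [j`!%:R * _]mulrC.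
rewrite factS natrM invfM mulrCA; congr (_ * _).
by rewrite -mulrA mulVf ?mulr1 // fact_neq0.
Qed.

Lemma iter_unipotent U m n v : iter m U v = 0 ->
  iter n (fun w => w + U w) v = \sum_(j < m) 'C(n, j)%:R *: iter j U v.
Proof.
case: m => [|m] mv.
  rewrite big_ord0; move: mv => /= ->.
  by elim: n => //= n ->; rewrite linear0 addr0.
elim: n => [|n IH].
  by rewrite big_ord_recl big1 ?addr0 ?scale1r // => i _; rewrite bin0n scale0r.
rewrite iterS IH linear_sum /=.
rewrite [X in _ + X](eq_bigr (fun j : 'I_m.+1 => 'C(n, j)%:R *: iter j.+1 U v));
  last by move=> j _; rewrite linearZ.
rewrite [X in _ + X]big_ord_recr /= -[U (iter m U v)]/(iter m.+1 U v) mv.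
rewrite scaler0 addr0.
rewrite big_ord_recl [RHS]big_ord_recl !bin0 -addrA; congr (_ + _).
rewrite -big_split; apply: eq_bigr => j _.
by rewrite lift0 binS natrD scalerDl.
Qed.

Definition log_trunc U (n : nat) v : V :=
  \sum_(j < n) ((-1) ^+ j / j.+1%:R) *: iter j.+1 U v.

Lemma log_trunc_coef U n v :
  log_trunc U n v = \sum_(j < n.+1) (bin_poly j)`_1 *: iter j U v.
Proof.
rewrite big_ord_recl /bin_poly big_ord0 coefZ coef1 mulr0 scale0r add0r.
by apply: eq_bigr => j _; rewrite lift0 bin_poly_coef1.
Qed.

(** The linear coefficients in [k] of the two sides of
[(1 + U)^k B(u, v) = B((1 + U)^k u, (1 + U)^k v)] are compared. On the right,
the linear coefficient of a product of binomial polynomials only involves the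
terms where one of the two factors is ['C(X, 0) = 1]. *)
Lemma log_trunc_derivation (B : {bilinear V -> V -> V}) U n u v :
  (forall u v, B u v + U (B u v) = B (u + U u) (v + U v)) ->
  iter n U u = 0 -> iter n U v = 0 -> iter n U (B u v) = 0 ->
  log_trunc U n (B u v) = B (log_trunc U n u) v + B u (log_trunc U n v).
Proof.
move=> UB nu nv nuv.
have le_n := leqnSn n.
have hB k : iter k (fun w => w + U w) (B u v) =
    B (iter k (fun w => w + U w) u) (iter k (fun w => w + U w) v).
  by elim: k => //= k ->; rewrite UB.
rewrite log_trunc_coef.
rewrite (@eq_vector_poly_coef _ ('I_n.+1 * 'I_n.+1)%type
  (fun j : 'I_n.+1 => bin_poly j)
  (fun ab => bin_poly ab.1 * bin_poly ab.2) _
  (fun ab => B (iter ab.1 U u) (iter ab.2 U v))).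
  rewrite -(pair_bigA _ (fun a b : 'I_n.+1 => (bin_poly a * bin_poly b)`_1 *:
    B (iter a U u) (iter b U v))) /=.
  have E (a b : nat) : (bin_poly a * bin_poly b)`_1 =
      (bin_poly a)`_1 * (b == 0)%:R + (a == 0)%:R * (bin_poly b)`_1.
    by rewrite coefM big_ord_recr big_ord1 /= !bin_poly_coef0 addrC.
  under eq_bigr => a _ do under eq_bigr => b _ do rewrite E scalerDl.
  under eq_bigr => a _ do rewrite big_split /=.
  rewrite big_split /= !log_trunc_coef linear_sumlz linear_sum; congr (_ + _).
    apply: eq_bigr => a _; rewrite big_ord_recl big1 => [|b _].
      by rewrite mulr1 addr0 linearZl_LR.
    by rewrite lift0 mulr0 scale0r.
  rewrite big_ord_recl [X in _ + X]big1 => [|a _]; last first.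
    by apply: big1 => b _; rewrite lift0 mul0r scale0r.
  by rewrite addr0; apply: eq_bigr => b _; rewrite mul1r linearZ.
move=> k; under eq_bigr do rewrite bin_poly_nat.
rewrite -(iter_unipotent _ (iter_eq0_le le_n nuv)) hB.
rewrite (iter_unipotent _ (iter_eq0_le le_n nu)).
rewrite (iter_unipotent _ (iter_eq0_le le_n nv)).
rewrite linear_sumlz -(pair_bigA _ (fun a b : 'I_n.+1 =>
    (bin_poly a * bin_poly b).[k%:R] *: B (iter a U u) (iter b U v))) /=.
apply: eq_bigr => a _; rewrite linear_sum; apply: eq_bigr => b _.
by rewrite linearZ /= linearZl_LR /= scalerA hornerM !bin_poly_nat mulrC.
Qed.

End LocallyNilpotent.

(** * The logarithm of an automorphism *)

Section Multiplicativity.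
Variables (F : fieldType) (V : lmodType F) (g : {linear V -> V}).
Variable B : {bilinear V -> V -> V}.
Hypothesis gB : forall u v, g (B u v) = B (g u) (g v).

(** The identity
[(g - l m) B(u, v) = B((g - l) u, g v) + l B(u, (g - m) v)]
lowers the nilpotency order of one argument and does not raise the other one. *)
Lemma gen_eigen_mult l m u v :
  gen_eigen g l u -> gen_eigen g m v -> gen_eigen g (l * m) (B u v).
Proof.
have step (c : F) k w : polyop g (('X - c%:P) ^+ k.+1) w =
    polyop g (('X - c%:P) ^+ k) (g w - c *: w).
  by rewrite !polyop_XsubC_exp iterSr.
move=> [a au] [b bv]; exists (a + b)%N.
elim: a b u v au bv => [|a IHa] b u v.
  by rewrite expr0 polyop1 => -> _; rewrite linear0l linear0.
move=> au; elim: b v => [|b IHb] v.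
  by rewrite expr0 polyop1 => ->; rewrite linear0r linear0.
move=> bv; rewrite addSn step.
have -> : g (B u v) - (l * m) *: B u v =
    B (g u - l *: u) (g v) + l *: B u (g v - m *: v).
  rewrite gB linearBl linearBr scalerBr linearZl_LR.
  rewrite [X in _ - _ + (_ - l *: X)]linearZr_LR.
  by rewrite scalerA addrA subrK.
rewrite linearD /= IHa ?add0r.
- by rewrite linearZ /= addnS -addSn IHb ?scaler0 // -step.
- by rewrite -step.
- by rewrite polyop_comm bv linear0.
Qed.

Lemma spectral_rel_mult (f : F -> F) u u' v v' :
  (forall l m, f (l * m) = f l * f m) ->
  spectral_rel g f u u' -> spectral_rel g f v v' ->
  spectral_rel g f (B u v) (B u' v').
Proof.
move=> fM [s [sE -> ->]] [t [tE -> ->]]; rewrite !linear_sumlz.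
apply: spectral_rel_sum => x xs; rewrite !linear_sum.
apply: spectral_rel_sum => y yt /=.
have := spectral_rel1 f (gen_eigen_mult (sE _ xs) (tE _ yt)).
by rewrite fM -scalerA -linearZr_LR -linearZl_LR.
Qed.

End Multiplicativity.

Section Logarithm.
Variable R : realType.
Local Notation C := R[i].

(** The branch of [log / 2 pi i] with real part at least [0] and less than
[1], on the nonzero complex numbers. *)
Definition clog (l : C) : C :=
  xget 0 [set x | 0 <= complex.Re x < 1 /\ expC (twopii R * x) = l].

Lemma clogP (l : C) : l != 0 ->
  0 <= complex.Re (clog l) < 1 /\ expC (twopii R * clog l) = l.
Proof.
move=> l0; have [x x01 xl] := expC_twopii_surj l0.
exact: (@xgetPex _ 0 [set x | 0 <= complex.Re x < 1 /\ expC (twopii R * x) = l])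
  (ex_intro _ x (conj x01 xl)).
Qed.

Lemma expCK (x : C) : 0 <= complex.Re x < 1 -> clog (expC (twopii R * x)) = x.
Proof.
move=> x01; have [y01] := clogP (expC_neq0 (twopii R * x)).
exact: expC_twopii_inj.
Qed.

End Logarithm.

Section Automorphism.
Variables (R : realType) (V : lmodType R[i]) (A : gr_vertex_superalgebra V).
Local Notation C := R[i].

(** The mode number comes first so that a bilinear structure can be attached to
[vmode n]. *)
Definition vmode (n : int) (u v : V) : V := gv_Y A u v n.

Lemma vmode_bilinear n : bilinear_for *:%R *:%R (vmode n).
Proof. by split=> w; [apply: gv_linear_l | apply: gv_linear_r]. Qed.
HB.instance Definition _ n :=
  bilinear_isBilinear.Build C V V V *:%R *:%R (vmode n) (vmode_bilinear n).

Lemma wtspace_lin k a (u v : V) :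
  wtspace (gv_pr A) k u -> wtspace (gv_pr A) k v ->
  wtspace (gv_pr A) k (a *: u + v).
Proof. by rewrite /wtspace /= => ku kv; rewrite linearP /= ku kv. Qed.

Lemma wtspace0 k : wtspace (gv_pr A) k 0.
Proof. by rewrite /wtspace /= linear0. Qed.

Lemma wtspaceZ k a (v : V) :
  wtspace (gv_pr A) k v -> wtspace (gv_pr A) k (a *: v).
Proof.
by move=> kv; rewrite -[_ *: _]addr0; apply: wtspace_lin (wtspace0 k).
Qed.

Lemma wtspace_sum k (I : Type) (r : seq I) (P : pred I) (v : I -> V) :
  (forall i, P i -> wtspace (gv_pr A) k (v i)) ->
  wtspace (gv_pr A) k (\sum_(i <- r | P i) v i).
Proof.
move=> kv; apply: (big_ind (wtspace (gv_pr A) k)) => //; first exact: wtspace0.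
by move=> x y kx ky; rewrite -[x]scale1r; apply: wtspace_lin.
Qed.

Variable g : {linear V -> V}.
Hypothesis ginj : injective g.
Hypothesis gwt : forall k v, wtspace (gv_pr A) k v -> wtspace (gv_pr A) k (g v).
Hypothesis gY : forall u v n, g (gv_Y A u v n) = gv_Y A (g u) (g v) n.

Let locfin := locally_finite gwt.
Local Notation T := (spectral_op g).

Lemma spectral_op_wtspace f k v :
  wtspace (gv_pr A) k v -> wtspace (gv_pr A) k (T f v).
Proof.
move=> kv; have [p ->] := spectral_rel_polyop (spectral_opP locfin f v).
by apply: polyop_stable kv => [a u w|]; [apply: wtspace_lin | apply: gwt].
Qed.

Lemma spectral_op_vmode f n u v : (forall l m, f (l * m) = f l * f m) ->
  T f (vmode n u v) = vmode n (T f u) (T f v).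
Proof.
move=> fM; apply: spectral_opE => //; apply: spectral_rel_mult => //; last 2 first.
- exact: spectral_opP.
- exact: spectral_opP.
by move=> x y; apply: gY.
Qed.

Lemma gen_eigen_neq0 l v : gen_eigen g l v -> v != 0 -> l != 0.
Proof.
move=> lv /(gen_eigen_eigenvector lv)[w w0 gw].
apply: contra_neq w0 => l0; apply: ginj.
by rewrite linear0 gw l0 scale0r.
Qed.

(** Since [g] is injective, [0] is not an eigenvalue. *)
Lemma eq_spectral_op f f' : (forall l, l != 0 -> f l = f' l) -> T f =1 T f'.
Proof.
move=> ff' v; symmetry; apply: spectral_opE => //.
have [s [sE -> ->]] := spectral_opP locfin f v.
apply: spectral_rel_sum => x xs; have [->|x0] := eqVneq x.2 0.
  by rewrite scaler0; apply: spectral_rel0.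
rewrite ff'; first by apply: spectral_rel1; apply: sE.
by apply: gen_eigen_neq0 x0; apply: sE.
Qed.

Lemma spectral_op_comp f h v : T h (T f v) = T (fun l => h l * f l) v.
Proof.
by apply: spectral_opE => //; apply: spectral_rel_comp; apply: spectral_opP.
Qed.

Lemma spectral_op_id v : T (fun=> 1) v = v.
Proof.
apply: spectral_opE => //.
have [s [sE -> _]] := spectral_opP locfin (fun=> 1) v.
apply: spectral_rel_sum => x xs; rewrite -[X in spectral_rel _ _ _ X]scale1r.
by apply: spectral_rel1; apply: sE.
Qed.

Lemma spectral_op_bijective f : (forall l, l != 0 -> f l != 0) -> bijective (T f).
Proof.
move=> f0; exists (T (fun l => (f l)^-1)) => v;
  rewrite spectral_op_comp -[RHS]spectral_op_id;
  by apply: eq_spectral_op => l /f0 fl; rewrite (mulVf, mulfV).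
Qed.

Lemma spectral_op_automorphism f : (forall l, l != 0 -> f l != 0) ->
  (forall l m, f (l * m) = f l * f m) -> is_automorphism A (T f).
Proof.
move=> f0 fM; split.
- exact: spectral_op_linear.
- exact: spectral_op_bijective.
- exact: spectral_op_wtspace.
- by move=> u v n; apply: spectral_op_vmode.
Qed.

Lemma gen_eigenspaceE x v :
  gen_eigenspace g x v <-> gen_eigen g (expC (twopii R * x)) v.
Proof. by split=> -[k kv]; exists k; move: kv; rewrite polyop_XsubC_exp. Qed.

(** The decompositions that define [log_ss] index generalized eigenvectors by
logarithms without repetition; the components of an arbitrary decomposition are
grouped by logarithm to obtain one. *)
Lemma log_ssE : log_ss g = T (@clog R).
Proof.
apply/funext => v.
pose is_log w := exists (s : seq C) (c : C -> V),
  [/\ uniq s,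
      forall alpha, alpha \in s ->
        P_V g alpha /\ gen_eigenspace g alpha (c alpha),
      v = \sum_(alpha <- s) c alpha &
      w = \sum_(alpha <- s) alpha *: c alpha].
have log_uniq w : is_log w -> w = T (@clog R) v.
  move=> [s [c [_ sP -> ->]]]; symmetry; apply: spectral_opE => //.
  apply: spectral_rel_sum => x /sP[[x01 _] /gen_eigenspaceE xc].
  by rewrite -{2}(expCK x01); apply: spectral_rel1.
apply: xget_unique => //.
have [s0 [s0E vE _]] := spectral_opP locfin (fun=> 1) v.
(* Zero components are discarded: a nonzero one is needed to show that [x.1]
   is an eigenvalue of [g]. *)
pose s := [seq x <- s0 | x.2 != 0].
have sE x : x \in s -> gen_eigen g x.1 x.2 /\ x.1 != 0.
  rewrite mem_filter => /andP[x0 /s0E xE]; split=> //.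
  exact: gen_eigen_neq0 xE x0.
pose r := undup [seq clog x.1 | x <- s].
pose c y := \sum_(x <- s | clog x.1 == y) x.2.
suff w : is_log (\sum_(alpha <- r) alpha *: c alpha) by rewrite -(log_uniq _ w).
exists r, c; split=> //; first exact: undup_uniq.
- move=> y; rewrite mem_undup => /mapP[x xs ->]; have [xE x0] := sE x xs.
  have [re01 ex] := clogP x0.
  have x20 : x.2 != 0 by move: xs; rewrite mem_filter => /andP[].
  split; first by split=> //; rewrite ex; apply: gen_eigen_eigenvector xE x20.
  apply/gen_eigenspaceE; rewrite ex /c big_seq_cond.
  apply: (big_ind (gen_eigen g x.1)) => [||z /andP[zs /eqP zx]].
  + exact: gen_eigen0.
  + by move=> u w; apply: gen_eigenD.
  + have [zE z0] := sE z zs; suff -> : x.1 = z.1 by [].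
    by rewrite -ex -zx; have [] := clogP z0.
- rewrite vE /c (exchange_big_dep xpredT) //=.
  rewrite (bigID (fun x : C * V => x.2 != 0)) /= [X in _ + X]big1 ?addr0; last first.
    by move=> x; rewrite negbK => /eqP.
  rewrite -big_filter big_seq [RHS]big_seq; apply: eq_bigr => x xs.
  have xr : clog x.1 \in r by rewrite mem_undup; apply: map_f.
  rewrite -big_filter (_ : [seq y <- r | _] = [:: clog x.1]) ?big_seq1 //.
  rewrite -(filter_pred1_uniq (undup_uniq _) xr); apply: eq_filter => y.
  by rewrite eq_sym.
Qed.

(** On a generalized eigenvector the series is the scalar exponential series at
[z * clog l]. *)
Lemma expop_log_ss z : expop A z (log_ss g) =1 T (fun l => expC (z * clog l)).
Proof.
move=> v; rewrite /expop log_ssE; apply: vsumE => phi _.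
have [s [sE vE wE]] := spectral_opP locfin (fun l => expC (z * clog l)) v.
rewrite wE vE {wE vE v}.
have iterT k : iter k (T (@clog R)) (\sum_(x <- s) x.2) =
    \sum_(x <- s) clog x.1 ^+ k *: x.2.
  elim: k => [|k IH]; first by apply: eq_bigr => x _; rewrite expr0 scale1r.
  rewrite iterS IH; apply: spectral_opE => //; apply: spectral_rel_sum => x xs.
  rewrite exprS -scalerA; apply: spectral_rel1; rewrite -(polyopC g).
  exact/gen_eigen_polyop/sE.
have -> : (fun n => \sum_(k < n) phi ((z ^+ k / k`!%:R) *:
      iter k (T (@clog R)) (\sum_(x <- s) x.2)) : C^o) =
    (fun n => \sum_(x <- s) exp_psum (z * clog x.1) n * phi x.2).
  apply/funext => n.
  under eq_bigr => k _ do rewrite iterT linearZ linear_sum /= mulr_sumr.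
  rewrite exchange_big; apply: eq_bigr => x _; rewrite mulr_suml.
  by apply: eq_bigr => k _; rewrite linearZ /= exprMn [z ^+ k * _ / _]mulrAC mulrA.
rewrite linear_sum; apply: cvg_big => [|x _]; first exact: add_continuous.
rewrite linearZ; apply: cvgM; [exact: cvg_exp_psum | exact: cvg_cst].
Qed.

Lemma expop_twopii_log_ss : expop A (twopii R) (log_ss g) = T id.
Proof.
apply/funext => v; rewrite expop_log_ss; apply: eq_spectral_op => l l0.
by have [] := clogP l0.
Qed.

Lemma expop_Ntwopii_log_ss : expop A (- twopii R) (log_ss g) = T GRing.inv.
Proof.
apply/funext => v; rewrite expop_log_ss; apply: eq_spectral_op => l l0.
by rewrite mulNr expCN; have [_ ->] := clogP l0.
Qed.

Lemma exp_log_ss_automorphism :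
  is_automorphism A (expop A (twopii R) (log_ss g)).
Proof. by rewrite expop_twopii_log_ss; apply: spectral_op_automorphism. Qed.

Local Notation U := (unip_minus_id A g).

Lemma unipE v : U v = T GRing.inv (g v) - v.
Proof. by rewrite /unip_minus_id expop_Ntwopii_log_ss. Qed.

Lemma unip_linear : linear U.
Proof.
move=> a u v; rewrite !unipE linearP (spectral_op_linear locfin) scalerBr opprD.
by rewrite addrACA.
Qed.
HB.instance Definition _ := GRing.isLinear.Build C V V *:%R U unip_linear.

Lemma unip_wtspace k v : wtspace (gv_pr A) k v -> wtspace (gv_pr A) k (U v).
Proof.
move=> kv; rewrite unipE -[_ - _]addrC -scaleN1r; apply: wtspace_lin => //.
exact/spectral_op_wtspace/gwt.
Qed.

Lemma unip_vmode n u v :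
  vmode n u v + U (vmode n u v) = vmode n (u + U u) (v + U v).
Proof.
have hE w : w + U w = T GRing.inv (g w) by rewrite unipE addrC subrK.
rewrite !hE -spectral_op_vmode; last exact: invfM.
by congr (T _ _); apply: gY.
Qed.

(** On the generalized eigenspace of [l], [U] is [l^-1 (g - l)]. *)
Lemma unip_nilpotent v : exists n, iter n U v = 0.
Proof.
have [s [sE -> _]] := spectral_opP locfin id v.
elim: s sE => [|x s IH] sE; first by exists 0%N; rewrite big_nil.
have [|n ns] := IH; first by move=> y ys; apply: sE; rewrite inE ys orbT.
have [k kx] : gen_eigen g x.1 x.2 by apply: sE; rewrite mem_head.
exists (maxn n k); rewrite big_cons -[x.2]scale1r iter_linear.
rewrite (iter_eq0_le (leq_maxl n k) ns) addr0 scale1r.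
apply: (iter_eq0_le (leq_maxr n k)).
have [x0|x0] := eqVneq x.2 0.
  by rewrite x0; elim: (k) => //= m ->; rewrite linear0.
have l0 : x.1 != 0 by apply: gen_eigen_neq0 x0; exists k.
suff -> m : iter m U x.2 = x.1 ^- m *: polyop g (('X - x.1%:P) ^+ m) x.2.
  by rewrite kx scaler0.
have U1 w : gen_eigen g x.1 w -> U w = x.1^-1 *: polyop g ('X - x.1%:P) w.
  move=> lw; rewrite unipE (spectral_op_gen_eigen locfin _ (gen_eigen_stable lw)).
  rewrite -[X in polyop g X]expr1 polyop_XsubC_exp /= scalerBr scalerA mulVf //.
  by rewrite scale1r.
elim: m => [|m IHm]; first by rewrite invr1 scale1r expr0 polyop1.
rewrite iterS IHm linearZ /= U1; last by apply: gen_eigen_polyop; exists k.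
by rewrite scalerA -invfM -exprSr -polyopM -exprS.
Qed.

Local Notation N := (log_nil A g).

Lemma log_nilE n v : iter n U v = 0 -> N v = (twopii R)^-1 *: log_trunc U n v.
Proof.
move=> nv; congr (_ *: _); apply: vsum_finite => k nk.
by rewrite (iter_eq0_le (leqW nk) nv) scaler0.
Qed.

Lemma log_nil_linear : linear N.
Proof.
move=> a u v; have [n nu] := unip_nilpotent u; have [m mv] := unip_nilpotent v.
have nu' := iter_eq0_le (leq_maxl n m) nu.
have mv' := iter_eq0_le (leq_maxr n m) mv.
rewrite (@log_nilE (maxn n m)) ?iter_linear ?nu' ?mv' ?scaler0 ?addr0 //.
rewrite (log_nilE nu') (log_nilE mv') !scalerA mulrC -scalerA -scalerDr.
congr (_ *: _); rewrite /log_trunc scaler_sumr -big_split.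
by apply: eq_bigr => k _; rewrite iter_linear /= scalerDr !scalerA mulrC.
Qed.
HB.instance Definition _ := GRing.isLinear.Build C V V *:%R N log_nil_linear.

Lemma log_nil_wtspace k v : wtspace (gv_pr A) k v -> wtspace (gv_pr A) k (N v).
Proof.
move=> kv; have [n nv] := unip_nilpotent v; rewrite (log_nilE nv).
apply/wtspaceZ/wtspace_sum => j _; apply: wtspaceZ.
by elim: (j.+1) => //= i; apply: unip_wtspace.
Qed.

(** [N] is [U] times a polynomial in [U], so it lowers the nilpotency order with
respect to [U]. *)
Lemma log_nil_nilpotent v : exists n, iter n N v = 0.
Proof.
have [n nv] := unip_nilpotent v; exists n.
elim: n v nv => // n IH v nv; rewrite iterSr; apply: IH.
rewrite (log_nilE nv) linearZ linear_sum /= big1 ?scaler0 // => j _.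
rewrite linearZ /= -iterS -iterD addnS -addSn (iter_eq0_le _ nv);
  by rewrite ?leq_addr ?scaler0.
Qed.

Lemma log_nil_vmode n u v :
  N (vmode n u v) = vmode n (N u) v + vmode n u (N v).
Proof.
have [a au] := unip_nilpotent u; have [b bv] := unip_nilpotent v.
have [c cuv] := unip_nilpotent (vmode n u v).
pose m := maxn (maxn a b) c.
have mu : iter m U u = 0.
  by apply: iter_eq0_le au; rewrite /m -maxnA leq_maxl.
have mv : iter m U v = 0.
  by apply: iter_eq0_le bv; rewrite /m maxnAC leq_maxr.
have muv : iter m U (vmode n u v) = 0 by apply: iter_eq0_le cuv; rewrite leq_maxr.
rewrite (log_nilE mu) (log_nilE mv) (log_nilE muv).
rewrite (log_trunc_derivation (unip_vmode n)) //.
by rewrite linearZl_LR [X in _ = _ + X]linearZr_LR scalerDr.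
Qed.

Lemma log_nil_derivation : is_derivation A N.
Proof.
split=> [|u v n]; first exact: log_nil_linear.
by apply/eqP; rewrite subr_eq; apply/eqP; apply: log_nil_vmode.
Qed.

Lemma expop_log_nil t n v : iter n N v = 0 -> expop A t N v = exp_trunc N t n v.
Proof.
by move=> nv; apply: vsum_finite => k nk; rewrite (iter_eq0_le nk nv) scaler0.
Qed.

Lemma iter_exp_trunc n t m v :
  iter n N v = 0 -> iter n N (exp_trunc N t m v) = 0.
Proof.
move=> nv; rewrite linear_sum big1 // => j _.
by rewrite linearZ /= -iterD (iter_eq0_le _ nv) ?leq_addr ?scaler0.
Qed.

Lemma expop_log_nil_add s t v :
  expop A s N (expop A t N v) = expop A (s + t) N v.
Proof.
have [n nv] := log_nil_nilpotent v.
rewrite (expop_log_nil t nv) (expop_log_nil s (n := n)) ?iter_exp_trunc //.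
by rewrite exp_trunc_add // -expop_log_nil.
Qed.

Lemma expop_log_nil0 v : expop A 0 N v = v.
Proof.
have [n nv] := log_nil_nilpotent v.
by rewrite (@expop_log_nil _ n.+1) ?exp_trunc0 // (iter_eq0_le (leqnSn n)).
Qed.

Lemma exp_log_nil_automorphism t : is_automorphism A (expop A t N).
Proof.
split.
- move=> a u v; have [n nu] := log_nil_nilpotent u.
  have [m mv] := log_nil_nilpotent v.
  have nu' := iter_eq0_le (leq_maxl n m) nu.
  have mv' := iter_eq0_le (leq_maxr n m) mv.
  rewrite (@expop_log_nil _ (maxn n m)) ?iter_linear ?nu' ?mv' ?scaler0 ?addr0 //.
  by rewrite linearP (expop_log_nil t nu') (expop_log_nil t mv').
- exists (expop A (- t) N) => v; rewrite expop_log_nil_add;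
    by rewrite ?addNr ?subrr expop_log_nil0.
- move=> k v kv; have [n nv] := log_nil_nilpotent v.
  rewrite (expop_log_nil t nv); apply: wtspace_sum => j _; apply: wtspaceZ.
  by elim: (j : nat) => //= i; apply: log_nil_wtspace.
- move=> u v n; rewrite -!/(vmode n _ _).
  have [a au] := log_nil_nilpotent u; have [b bv] := log_nil_nilpotent v.
  have [c cuv] := log_nil_nilpotent (vmode n u v).
  pose m := maxn (maxn a b) c.
  have mu : iter m N u = 0.
    by apply: iter_eq0_le au; rewrite /m -maxnA leq_maxl.
  have mv : iter m N v = 0.
    by apply: iter_eq0_le bv; rewrite /m maxnAC leq_maxr.
  have muv : iter m N (vmode n u v) = 0.
    by apply: iter_eq0_le cuv; rewrite leq_maxr.
  have le2 := leq_addr m m.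
  rewrite !(@expop_log_nil t (m + m)) ?(iter_eq0_le le2) //.
  by apply: exp_trunc_mult => // u' v'; apply: log_nil_vmode.
Qed.

Lemma fexp_log_nil u v n k :
  fexp N (gv_Y A u v n) k = Yseries A (fexp N u) (fexp N v) n k.
Proof. exact: (divided_leibniz (log_nil_vmode n)). Qed.

End Automorphism.

Theorem proposition2p6 (R : realType) (V : lmodType (complex R))
    (A : gr_vertex_superalgebra V) (g : V -> V) (hg : is_automorphism A g) :
  (is_automorphism A (expop A (twopii R) (log_ss g)) /\
   is_automorphism A (expop A (twopii R) (log_nil A g))) /\
  is_derivation A (log_nil A g) /\
  ((forall t : complex R, is_automorphism A (expop A t (log_nil A g))) /\
   (forall (u v : V) (n : int) (k : nat),
     fexp (log_nil A g) (gv_Y A u v n) k =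
     Yseries A (fexp (log_nil A g) u) (fexp (log_nil A g) v) n k) /\
   (forall (u v : V) (n : int) (k : nat),
     fpow (log_nil A g) (gv_Y A u v n) k =
     Yseries A (fpow (log_nil A g) u) (fpow (log_nil A g) v) n k)).
Proof.
have [glin /bij_inj ginj gwt gY] := hg.
pose gl : {linear V -> V} := HB.pack g (GRing.isLinear.Build _ _ _ _ g glin).
have exp_ss := @exp_log_ss_automorphism R V A gl ginj gwt gY.
have exp_nil := @exp_log_nil_automorphism R V A gl ginj gwt gY.
have der := @log_nil_derivation R V A gl ginj gwt gY.
have fexpY := @fexp_log_nil R V A gl ginj gwt gY.
exact: (conj (conj exp_ss (exp_nil _))
  (conj der (conj exp_nil (conj fexpY fexpY)))).
Qed.
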